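(* (1) Let $\mathcal{F}=(m_{i,j})$ be a finite frieze pattern of Type $\Lambda_{p_1,\ldots,p_s}$ of width $n-3$ which is realizable by a dissected $n$-gon $P$ with vertices $v_1,\ldots,v_n$. Then for all $i,j$ with $0\le j-i\le n$, $m_{i,j}=\sum_{w\in\mathcal{M}_{i,j}}wt_L(w)$, where $\mathcal{M}_{i,j}$ is the set of matchings between $v_i$ and $v_j$ in $P$. (2) Let $\mathcal{F}=(m_{i,j})$ be an infinite $n$-periodic frieze pattern of Type $\Lambda_{p_1,\ldots,p_s}$ which is realizable by a dissection of $S_n$ or $A_{n,m}$ or by a quotient dissection of $A_{n,m}$, and let $I$ be the dissected infinite strip which is its universal cover, with lower marked points $u_i$, $i\in\mathbb{Z}$, $u_i$ lying over $v_{i\bmod n}$. Then for all $j\ge i$, $m_{i,j}=\sum_{w\in\mathcal{M}_{i,j}}wt_L(w)$, where $\mathcal{M}_{i,j}$ is the set of matchings between $u_i$ and $u_j$ in $I$.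
   Context: Frieze pattern: array $(m_{i,j})_{j\ge i}$ of reals with $m_{i,i}=0$, $m_{i,i+1}=1$, $m_{i-1,j}m_{i,j+1}-m_{i,j}m_{i+1,j+1}=1$; finite of width $w$ if additionally $m_{i,i+w+3}=0$ for all $i$ (rows beyond are not considered); quiddity row $m_{i-1,i+1}$; $n$-periodic if the quiddity row is. $\lambda_p=2\cos(\pi/p)$; Type $\Lambda_{p_1,\ldots,p_s}$: quiddity entries are sums of positive integer multiples of $\lambda_{p_1},\ldots,\lambda_{p_s}$. $U_k$ are the normalized Chebyshev polynomials: $U_{-1}=0$, $U_0=1$, $U_k(x)=xU_{k-1}(x)-U_{k-2}(x)$. Dissections: a dissection of a polygon, of $A_{n,m}$ (annulus with $n$ outer, $m$ inner marked points) or of $S_n$ (disc with $n$ boundary marked points and a puncture) is a set of non-crossing arcs between marked points dividing the surface into polygons (subgons), $|\mathcal{P}|$ = number of sides; for $A_{n,m}$ no arc joins two inner points. Outer/boundary vertices $v_1,\ldots,v_n$ counterclockwise, indices mod $n$. A frieze pattern is realizable by the dissection if $m_{i-1,i+1}=\sum\lambda_{|\mathcal{P}|}$ over subgons $\mathcal{P}$ incident to $v_i$ (counted by corners at $v_i$). A quotient dissection of $A_{n,m}$ is obtained from a dissection by iteratively identifying pairs of equal-size subgons sharing an outer vertex, never identifying two subgons that share an edge nor subgons with all vertices on the outer boundary; its incidence at $v_i$ counts identified subgons once, and realizability is defined likewise. Universal cover: for $A_{n,m}$, cut along a bridging arc (joining $v_1$ to an inner point) and glue $\mathbb{Z}$ copies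 of the resulting dissected polygon along this arc, giving a periodically dissected infinite strip with lower marked points $u_i$ ($i\in\mathbb{Z}$, in order) lying over $v_{i\bmod n}$ and upper marked points over inner vertices. For $S_n$, the strip has lower marked points $u_i$ and a point $+\infty$; each arc from $v_a$ to the puncture lifts to arcs from every $u_i$ with $i\equiv a$ to $+\infty$, and the regions between them are dissected as the corresponding regions of $S_n$. The covering map preserves subgon sizes and the subgons incident to $u_i$ correspond to the corners at $v_{i\bmod n}$. For a quotient dissection, lifts of two identified subgons that are incident to a common lift of their shared outer vertex are identified in the strip. Matchings: in a dissected $n$-gon (indices mod $n$) or in the strip (vertices $u_k$), a matching between the $i$-th and $j$-th vertex ($j\ge i$) is a sequence $w=(\mathcal{P}_{i+1},\ldots,\mathcal{P}_{j-1})$ where $\mathcal{P}_k$ is a subgon incident to the $k$-th vertex; $\mathcal{M}_{i,i+1}=\{\emptyset\}$, $\mathcal{M}_{i,i}=\emptyset$. Local weight: $wt_L(\emptyset)=1$; if the first $k\ge1$ entries of $w$ equal $\mathcal{P}_{i+1}$ and the $(k+1)$-st does not (or $w$ has length $k$), then $wt_L(w)=U_k(\lambda_{|\mathcal{P}_{i+1}|})\,wt_L(\mathcal{P}_{i+k+1},\ldots,\mathcal{P}_{j-1})$, where equality of subgons is equality in the polygon or strip (with identifications in the quotient case).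
   Formalization: The unimodular rule is taken as m_{i-1,j}m_{i,j+1} − m_{i,j}m_{i-1,j+1} = 1 (the printed one is a misprint), and for quotient dissections the frieze is assumed tame (adjacent 3×3 minors vanish), since otherwise zero entries leave it undetermined and the claim fails. *)

(* Defs.v *)
From HB Require Import structures.
From mathcomp Require Import all_boot all_order all_algebra.
From mathcomp Require Import all_classical all_reals all_analysis.
From Stdlib Require Import Relation_Operators.

Set Implicit Arguments.
Unset Strict Implicit.
Unset Printing Implicit Defensive.

Import Order.TTheory GRing.Theory Num.Theory.

Local Open Scope classical_set_scope.
Local Open Scope ring_scope.

Section Friezes.
Variable R : realType.
Implicit Type F : int -> int -> R.

Definition lambda (p : nat) : R := 2 * cos (pi / p%:R).

(* Only the entries F i j with i <= j are ever constrained.  The four entries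
   of the unimodular rule form a diamond with left and right corners F (i-1) j
   and F i (j+1), top F i j and bottom F (i-1) (j+1). *)
Definition frieze F : Prop :=
  [/\ forall i, F i i = 0,
      forall i, F i (i + 1) = 1
    & forall i j, i <= j ->
        F (i - 1) j * F i (j + 1) - F i j * F (i - 1) (j + 1) = 1].

(* The rows j - i > w + 3 are left unconstrained. *)
Definition finite_frieze (w : nat) F : Prop :=
  [/\ forall i, F i i = 0,
      forall i, F i (i + 1) = 1,
      forall i j, i <= j -> (j + 1) - (i - 1) <= (w + 3)%:Z ->
        F (i - 1) j * F i (j + 1) - F i j * F (i - 1) (j + 1) = 1
    & forall i, F i (i + (w + 3)%:Z) = 0].

Definition quiddity F (i : int) : R := F (i - 1) (i + 1).

Definition n_periodic (n : nat) F : Prop :=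
  forall i, quiddity F (i + n%:Z) = quiddity F i.

(* A multiplicity may vanish for some of the p's, but not for all of them. *)
Definition type_Lambda (ps : seq nat) F : Prop :=
  all (leq 3) ps /\
  forall i, exists c : 'I_(size ps) -> nat,
    (exists k, (0 < c k)%N) /\
    quiddity F i = \sum_(k < size ps) (c k)%:R * lambda (nth 0%N ps k).

(* A frieze in the above sense need not be determined by its quiddity row once
   some entry F i j with i < j vanishes; a tame one always is. *)
Definition tame F : Prop :=
  forall i j, i + 2 <= j ->
    \det (\matrix_(r < 3, c < 3) F (i + r%:Z) (j + c%:Z)) = 0.

Fixpoint chebU (k : nat) (x : R) : R :=
  match k with
  | 0 => 1
  | k'.+1 => x * chebU k' x - (if k' is k''.+1 then chebU k'' x else 0)
  end.

End Friezes.

(* What a dissected polygon or strip contributes to matchings: the (possibly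
   identified) subgons, those incident to the k-th vertex for k : int, and their
   numbers of sides. *)
Record tiling := Tiling {
  tile :> choiceType;
  incident : int -> set tile;
  sides : tile -> nat
}.
Arguments incident : clear implicits.

Section Matchings.
Variables (R : realType) (T : tiling).

Definition realizable (F : int -> int -> R) : Prop :=
  forall i, quiddity F i = \sum_(P \in incident T i) lambda R (sides P).

(* Entry number k of w is the subgon chosen at vertex i + 1 + k; for j = i the
   length condition is unsatisfiable, for j = i + 1 it forces w = [::]. *)
Definition matchings (i j : int) : set (seq T) :=
  [set w | (size w)%:Z = j - i - 1 /\
           forall (P0 : T) (k : nat), (k < size w)%N ->
             incident T (i + 1 + k%:Z) (nth P0 w k)].

(* wtL_run P k w is the weight of k copies of P followed by w. *)
Fixpoint wtL_run (P : T) (k : nat) (w : seq T) : R :=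
  match w with
  | [::] => chebU k (lambda R (sides P))
  | Q :: w' => if Q == P then wtL_run P k.+1 w'
               else chebU k (lambda R (sides P)) * wtL_run Q 1 w'
  end.

Definition wtL (w : seq T) : R :=
  if w is P :: w' then wtL_run P 1 w' else 1.

Definition matching_sum (i j : int) : R := \sum_(w \in matchings i j) wtL w.

End Matchings.

(* V is the set of marked points of a disc, lt their order along the boundary
   circle cut open at one place.  An arc or side is a pair (x, y) with lt x y. *)
Section Dissections.
Variables (V : eqType) (lt side : rel V).

Record dissection := Dissection {
  arc : rel V;
  arc_lt : forall x y, arc x y -> lt x y;
  arc_not_side : forall x y, arc x y -> ~~ side x y;
  arc_noncrossing : forall x y z t, arc x y -> arc z t ->
    ~~ [&& lt x z, lt z y & lt y t]
}.

Definition edge (D : dissection) : rel V := fun x y => side x y || arc D x y.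

(* A subgon is the list of its vertices in boundary order: cyclically
   consecutive vertices, and no others, are joined by a side or an arc. *)
Definition subgon (D : dissection) (P : seq V) : Prop :=
  [/\ (2 < size P)%N, sorted lt P
    & forall x0 i j, (i < j < size P)%N ->
        edge D (nth x0 P i) (nth x0 P j) =
          (j == i.+1) || ((i == 0%N) && (j == (size P).-1))].

End Dissections.

Section Polygon.
Variable n : nat.

Definition polygon_lt : rel 'I_n := fun x y => (x < y)%N.

Definition polygon_side : rel 'I_n := fun x y =>
  (y == x.+1 :> nat) || ((x == 0 :> nat) && (y == n.-1 :> nat)).

Definition polygon_dissection := dissection polygon_lt polygon_side.

Definition polygon_tiling (D : polygon_dissection) : tiling :=
  @Tiling (seq 'I_n)
    (fun k => [set P | subgon D P /\
                       exists2 x : 'I_n, x \in P & (x%:Z = k %[mod n%:Z])%Z])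
    size.

End Polygon.

(* The universal cover of A_{n,m} is a strip with lower marked points inl i over
   the outer vertices and upper ones inr k over the inner vertices, both numbered
   from left to right.  Its boundary is read along the lower line from left to
   right, then along the upper line from right to left. *)
Definition ann_lt : rel (int + int) := fun x y =>
  match x, y with
  | inl i, inl j => i < j
  | inl _, inr _ => true
  | inr _, inl _ => false
  | inr k, inr l => l < k
  end.

Definition ann_side : rel (int + int) := fun x y =>
  match x, y with
  | inl i, inl j => j == i + 1
  | inr k, inr l => k == l + 1
  | _, _ => false
  end.

Definition ann_deck (n m : nat) (t : int) (x : int + int) : int + int :=
  match x with
  | inl i => inl (i + t * n%:Z)
  | inr k => inr (k + t * m%:Z)
  end.

(* An isotopy class of arcs in A_{n,m} is an orbit of strip arcs under deck
   transformations, so a set of arcs in A_{n,m} is a deck-invariant set of strip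
   arcs.  The regions are polygons iff some arc joins the two boundaries. *)
Record annulus_dissection (n m : nat) := AnnulusDissection {
  ann_strip :> dissection ann_lt ann_side;
  ann_periodic : forall t x y,
    arc ann_strip (ann_deck n m t x) (ann_deck n m t y) = arc ann_strip x y;
  ann_no_inner : forall k l, ~~ arc ann_strip (inr k) (inr l);
  ann_bridging : exists i k, arc ann_strip (inl i) (inr k)
}.

(* The corners at v_i are in bijection with the subgons of the strip incident to
   inl i, so this tiling also expresses realizability by the annulus itself. *)
Definition annulus_cover (n m : nat) (D : annulus_dissection n m) : tiling :=
  @Tiling (seq (int + int))
    (fun k => [set P | subgon D P /\ inl k \in P])
    size.

(* For S_n the upper boundary of the strip is the single point inr tt, which is
   +oo. *)
Definition punct_lt : rel (int + unit) := fun x y =>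
  match x, y with
  | inl i, inl j => i < j
  | inl _, inr _ => true
  | inr _, _ => false
  end.

Definition punct_side : rel (int + unit) := fun x y =>
  match x, y with
  | inl i, inl j => j == i + 1
  | _, _ => false
  end.

Definition punct_deck (n : nat) (t : int) (x : int + unit) : int + unit :=
  match x with
  | inl i => inl (i + t * n%:Z)
  | inr _ => inr tt
  end.

Record punctured_dissection (n : nat) := PuncturedDissection {
  punct_strip :> dissection punct_lt punct_side;
  punct_periodic : forall t x y,
    arc punct_strip (punct_deck n t x) (punct_deck n t y) = arc punct_strip x y;
  punct_bridging : exists i, arc punct_strip (inl i) (inr tt)
}.

Definition punctured_cover (n : nat) (D : punctured_dissection n) : tiling :=
  @Tiling (seq (int + unit))
    (fun k => [set P | subgon D P /\ inl k \in P])
    size.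

Section Quotient.
Variables (n m : nat) (D : annulus_dissection n m).
Implicit Types (P Q X Y : seq (int + int)) (E : seq (int + int) -> seq (int + int) -> Prop).

(* Subgons of the annulus are orbits of subgons of the strip. *)
Definition same_orbit P Q : Prop := exists t, Q = map (ann_deck n m t) P.

Definition share_outer_vertex P Q : Prop := exists k, inl k \in P /\ inl k \in Q.

Definition share_edge P Q : Prop :=
  exists x y, [/\ edge D x y, x \in P, y \in P, x \in Q & y \in Q].

Definition has_inner_vertex P : Prop := exists k, inr k \in P.

(* E relates the strip subgons lying over identified subgons of the annulus.  An
   identification is tested in the quotient reached so far: two classes share an
   edge as soon as some of their members do. *)
Definition identifiable E P Q : Prop :=
  [/\ subgon D P /\ subgon D Q, size P = size Q, share_outer_vertex P Q,
      has_inner_vertex P /\ has_inner_vertex Q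
    & forall P' Q', E P P' -> E Q Q' -> ~ share_edge P' Q'].

Definition identify E P Q X Y : Prop :=
  [\/ E X Y, E X P /\ E Q Y | E X Q /\ E P Y].

Inductive quotient_dissection :
    (seq (int + int) -> seq (int + int) -> Prop) -> Prop :=
| quotient_none : quotient_dissection same_orbit
| quotient_step E P Q : quotient_dissection E -> identifiable E P Q ->
    quotient_dissection (identify E P Q).

(* Lifts of one and the same subgon of the annulus are not identified by this
   rule, but may end up identified through lifts of others. *)
Definition strip_identified E X Y : Prop :=
  [/\ subgon D X /\ subgon D Y, E X Y, ~ same_orbit X Y
    & share_outer_vertex X Y].

Definition strip_class E P : set (seq (int + int)) :=
  [set Q | clos_refl_sym_trans _ (strip_identified E) P Q].

(* All members of a class have the same size. *)
Definition quotient_cover E : tiling :=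
  @Tiling (set (seq (int + int)))
    (fun k => [set strip_class E P | P in [set P | subgon D P /\ inl k \in P]])
    (fun C => size (xget [::] C)).

End Quotient.

(* Main.v *)
Require Import Defs.
From Stdlib Require Import Relation_Operators Operators_Properties.
From mathcomp Require Import all_boot all_order all_algebra zify ring lra.
From mathcomp Require Import all_classical all_reals all_analysis.

(* By the Chebyshev recursion, appending one more subgon to a matching shows that
   the matching sums S(i,j) satisfy S(i,j+1) = q_j S(i,j) - c_j S(i,j-1), where q is
   the quiddity row and c_j is the number of subgons incident to both the (j-1)-st
   and the j-th vertex.  Always c_j = 1: the boundary edge lies in a single subgon,
   and in a quotient a chain of identified subgons from one side of this edge to the
   other passes through that subgon.  A tame frieze obeys the same recursion.

   A frieze that is not assumed tame is determined by its quiddity row as soon as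
   the matching sums do not vanish.  For a dissected polygon they are positive: a
   function given at the two ends of one side extends over each subgon like
   k |-> a sin((p-1-k) pi/p) + b sin(k pi/p), and the extension solves the recursion,
   since around a vertex the contributions of the subgons telescope.  The matching
   sums are the Casoratian of two such solutions, which is positive by Sturm
   comparison with one of them.  A strip reduces to polygons by cutting it along two
   distant bridging arcs. *)

Set Implicit Arguments.
Unset Strict Implicit.
Unset Printing Implicit Defensive.
Import Order.TTheory GRing.Theory Num.Theory.

(** * Subgons of a polygon *)

Section Gon.
Variables (V : eqType) (lt e : rel V).
Implicit Types (P : seq V) (x y z p q r a b c : V).

Definition strict_total : Prop :=
  [/\ irreflexive lt, transitive lt & forall x y, x != y -> lt x y || lt y x].

Definition noncrossing : Prop :=
  forall x y z t, e x y -> e z t -> ~~ [&& lt x z, lt z y & lt y t].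

(* By conversion, subgon D is gon when e is edge D. *)
Definition gon P : Prop :=
  [/\ (2 < size P)%N, sorted lt P
    & forall x0 i j, (i < j < size P)%N ->
        e (nth x0 P i) (nth x0 P j) =
          (j == i.+1) || ((i == 0%N) && (j == (size P).-1))].

Definition no_between P a b := ~~ has (fun c => lt a c && lt c b) P.

Lemma no_betweenP P a b :
  reflect (forall c, c \in P -> lt a c -> lt c b -> False) (no_between P a b).
Proof.
apply: (iffP hasPn) => [nb c /nb + ac cb|nb c cP]; first by rewrite ac cb.
by apply/negP => /andP[]; exact: nb.
Qed.

Hypothesis lt_order : strict_total.

Lemma strict_irr x : lt x x = false. Proof. by case: lt_order => + _ _; apply. Qed.

Lemma strict_trans : transitive lt. Proof. by case: lt_order. Qed.

Lemma strict_asym x y : lt x y -> lt y x -> False.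
Proof. by move=> xy /(strict_trans xy); rewrite strict_irr. Qed.

Lemma strict_cases x y : [\/ x = y, lt x y | lt y x].
Proof.
have [->|] := eqVneq x y; first by constructor 1.
by case: lt_order => _ _ tot /tot/orP[]; [constructor 2|constructor 3].
Qed.

Lemma sorted_nth_lt x0 P i j : sorted lt P -> (i < size P)%N -> (j < size P)%N ->
  lt (nth x0 P i) (nth x0 P j) = (i < j)%N.
Proof.
move=> sP hi hj; have mono := sorted_ltn_nth strict_trans x0 sP.
case: (ltngtP i j) => [ij|ji|->]; [exact: mono| |exact: strict_irr].
by apply/negP => /strict_asym; apply; exact: mono.
Qed.

Lemma sorted_strict_uniq P : sorted lt P -> uniq P.
Proof. by apply: sorted_uniq => [|x]; [exact: strict_trans|exact: strict_irr]. Qed.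

Lemma sorted_head x0 P p : sorted lt P -> p \in P ->
  head x0 P = p \/ lt (head x0 P) p.
Proof.
move=> sP /(nthP x0)[i iP <-]; rewrite -nth0.
by case: i iP => [|i] iP; [left|right; rewrite sorted_nth_lt // (ltn_trans _ iP)].
Qed.

Lemma sorted_last x0 P p : sorted lt P -> p \in P ->
  p = last x0 P \/ lt p (last x0 P).
Proof.
move=> sP /(nthP x0)[i iP <-]; rewrite -nth_last.
have [->|il] := eqVneq i (size P).-1; [by left|right].
by rewrite sorted_nth_lt //; lia.
Qed.

Lemma no_between_nth x0 P i j : sorted lt P -> (i < j < size P)%N ->
  no_between P (nth x0 P i) (nth x0 P j) = (j == i.+1).
Proof.
move=> sP ij; apply/no_betweenP/eqP => [nb|-> c /(nthP x0)[k kP <-]]; last first.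
  by rewrite !sorted_nth_lt //; lia.
apply/eqP/negPn/negP => ji; apply: (nb (nth x0 P i.+1)).
- by apply: mem_nth; lia.
- by rewrite sorted_nth_lt //; lia.
- by rewrite sorted_nth_lt //; lia.
Qed.

Lemma sorted_straddle P z p r : sorted lt P -> z \notin P ->
  p \in P -> r \in P -> lt p z -> lt z r ->
  exists2 k, (k.+1 < size P)%N & lt (nth z P k) z && lt z (nth z P k.+1).
Proof.
move=> sP zP pP rP pz zr; set k := find (lt z) P.
have kP : (k < size P)%N by rewrite -has_find; apply/hasP; exists r.
have zk : lt z (nth z P k) by apply: nth_find; rewrite has_find.
have k0 : (0 < k)%N.
  rewrite lt0n; apply/eqP => k0; case: (sorted_head z sP pP); rewrite -nth0 -k0.
    by move=> kp; apply: (strict_asym pz); rewrite -kp.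
  by move=> /strict_trans/(_ pz)/strict_asym; apply.
exists k.-1; rewrite prednK // zk andbT.
have k1 : (k.-1 < k)%N by rewrite prednK.
have := before_find z k1; case: (strict_cases (nth z P k.-1) z) => // [kz|->//].
by move: zP; rewrite -kz mem_nth // (ltn_trans k1).
Qed.

Lemma gonE x0 P : gon P <->
  [/\ (2 < size P)%N, sorted lt P
    & forall a b, a \in P -> b \in P -> lt a b ->
        e a b = no_between P a b || (a == head x0 P) && (b == last x0 P)].
Proof.
have nthE y0 i j : sorted lt P -> (i < j < size P)%N ->
    no_between P (nth y0 P i) (nth y0 P j)
      || (nth y0 P i == head y0 P) && (nth y0 P j == last y0 P)
    = (j == i.+1) || ((i == 0%N) && (j == (size P).-1)).
  move=> sP ij; rewrite no_between_nth // -nth0 -nth_last.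
  by rewrite !nth_uniq ?sorted_strict_uniq //; lia.
split=> -[sz sP ed]; split=> //.
  move=> a b /(nthP x0)[i iP <-] /(nthP x0)[j jP <-].
  by rewrite sorted_nth_lt // => ij; rewrite ed ?nthE ?ij.
move=> y0 i j ij; rewrite -(nthE y0) // ed ?mem_nth ?sorted_nth_lt //; try lia.
by case: (P) sz.
Qed.

Lemma gon_sorted P : gon P -> sorted lt P. Proof. by case. Qed.

Lemma gon_edgeE x0 P a b : gon P -> a \in P -> b \in P -> lt a b ->
  e a b = no_between P a b || (a == head x0 P) && (b == last x0 P).
Proof. by case/(gonE x0) => _ _; apply. Qed.

Lemma gon_head_mem x0 P : gon P -> head x0 P \in P.
Proof. by case; case: P => // a P _ _ _; exact: mem_head. Qed.

Lemma gon_last_mem x0 P : gon P -> last x0 P \in P.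
Proof. by case; case: P => //= a P _ _ _; exact: mem_last. Qed.

Lemma gon_middle x0 P : gon P ->
  exists2 c, c \in P & lt (head x0 P) c && lt c (last x0 P).
Proof.
move=> [sz sP _]; exists (nth x0 P 1); first by apply: mem_nth; lia.
by rewrite -nth0 -nth_last !sorted_nth_lt //; lia.
Qed.

Lemma gon_base x0 P : gon P -> e (head x0 P) (last x0 P).
Proof.
move=> gP; have [c _ /andP[hc cl]] := gon_middle x0 gP.
by rewrite (gon_edgeE x0 gP) ?gon_head_mem ?gon_last_mem ?eqxx ?orbT ?(strict_trans hc).
Qed.

Lemma gon_straddle P z p r : gon P -> z \notin P ->
  p \in P -> r \in P -> lt p z -> lt z r ->
  exists a b, [/\ a \in P, b \in P, e a b, lt a z && lt z b & no_between P a b].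
Proof.
move=> [_ sP ed] zP pP rP pz zr.
have [k kP zk] := sorted_straddle sP zP pP rP pz zr.
exists (nth z P k), (nth z P k.+1); split=> //; try by apply: mem_nth; lia.
  by rewrite ed ?eqxx // ltnSn.
by rewrite no_between_nth ?ltnSn.
Qed.

Hypothesis e_noncrossing : noncrossing.

Lemma gon_edge_left_mem P x y p r : gon P -> e x y -> p \in P -> r \in P ->
  lt r x -> lt x p -> lt p y -> x \in P.
Proof.
move=> gP exy pP rP rx xp py; apply/negPn/negP => xP.
have [a [b [_ bP eab /andP[ax xb] /no_betweenP nb]]] := gon_straddle gP xP rP pP rx xp.
have lt_by : lt b y.
  case: (strict_cases b p) => [->//|bp|pb]; first exact: strict_trans bp py.
  by case: (nb p) => //; exact: strict_trans ax xp.
by have := e_noncrossing eab exy; rewrite ax xb lt_by.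
Qed.

Lemma gon_edge_right_mem P x y p r : gon P -> e x y -> p \in P -> r \in P ->
  lt y r -> lt x p -> lt p y -> y \in P.
Proof.
move=> gP exy pP rP yr xp py; apply/negPn/negP => yP.
have [a [b [aP _ eab /andP[ay yb] /no_betweenP nb]]] := gon_straddle gP yP pP rP py yr.
have xa : lt x a.
  case: (strict_cases a p) => [->//|ap|pa]; last exact: strict_trans xp pa.
  by case: (nb p) => //; exact: strict_trans py yb.
by have := e_noncrossing exy eab; rewrite xa ay yb.
Qed.

(* If (x, y) separated p from q, then x and y would belong to P, being joined by an
   edge without being neighbours in P. *)
Lemma gon_separated P x y p q : gon P -> e x y -> p \in P -> q \in P ->
  lt x p -> lt p y -> lt q x || lt y q -> False.
Proof.
move=> gP exy pP qP xp py out; have sP := gon_sorted gP.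
have eb := gon_base x gP; have hP := gon_head_mem x gP; have lP := gon_last_mem x gP.
have [hx yl xl hy] : [/\ lt q x -> lt (head x P) x, lt y q -> lt y (last x P),
    lt x (last x P) & lt (head x P) y].
  split=> [qx|yq||].
  - by case: (sorted_head x sP qP) => [->|/strict_trans]; last apply.
  - by case: (sorted_last x sP qP) => [<-|]; last exact: strict_trans.
  - by case: (sorted_last x sP pP) => [<-|]; last exact: strict_trans.
  - by case: (sorted_head x sP pP) => [->|/strict_trans]; last apply.
have [xP yP] : x \in P /\ y \in P.
  case/orP: out => [qx|yq].
    have xP := gon_edge_left_mem gP exy pP qP qx xp py; split=> //.
    case: (strict_cases y (last x P)) => [->//|yl'|ly].
      exact: (gon_edge_right_mem gP exy pP lP).
    by have := e_noncrossing eb exy; rewrite hx // xl ly.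
  have yP := gon_edge_right_mem gP exy pP qP yq xp py; split=> //.
  case: (strict_cases (head x P) x) => [<-//|hx'|xh].
    exact: (gon_edge_left_mem gP exy pP hP).
  by have := e_noncrossing exy eb; rewrite xh hy yl.
move: exy; rewrite (gon_edgeE x gP) //; last exact: strict_trans xp py.
case/orP => [/no_betweenP/(_ p)|/andP[/eqP xE /eqP yE]]; first exact.
by case/orP: out => [/hx|/yl]; rewrite -?xE -?yE strict_irr.
Qed.

End Gon.

Lemma ltn_strict_total : strict_total ltn.
Proof. by split=> [x|y x z|x y] /=; lia. Qed.

(* This is nthP with the type nat, for lia does not see through its eqType. *)
Lemma memn_nth (P : seq nat) v : v \in P -> exists2 k, k < size P & nth 0 P k = v.
Proof. by move/(nthP 0). Qed.

Lemma sorted_nth_ltn (P : seq nat) i j : sorted ltn P -> i < size P ->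
  j < size P -> (nth 0 P i < nth 0 P j) = (i < j).
Proof. exact: (sorted_nth_lt ltn_strict_total). Qed.

Lemma sorted_ltn_bounds (P : seq nat) v : sorted ltn P -> v \in P ->
  head 0 P <= v <= last 0 P.
Proof.
move=> sP vP; apply/andP; split.
  by case: (sorted_head ltn_strict_total 0 sP vP) => [->|/ltnW].
by case: (sorted_last ltn_strict_total 0 sP vP) => [->|/ltnW].
Qed.

Section CyclicNeighbors.
Variables (T : eqType) (x0 : T) (s : seq T).
Hypothesis s_uniq : uniq s.

Lemma next_uniq_nth k : k < size s ->
  next s (nth x0 s k) = nth x0 s (if k.+1 == size s then 0 else k.+1).
Proof.
move=> ks; rewrite next_nth mem_nth // index_uniq //.
case: s ks s_uniq => //= a t kt _; rewrite eqSS; case: eqP => [->|kt'].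
  by rewrite nth_default.
by apply: set_nth_default; lia.
Qed.

Lemma prev_uniq_nth k : k < size s ->
  prev s (nth x0 s k) = nth x0 s (if k == 0 then (size s).-1 else k.-1).
Proof.
move=> ks; rewrite prev_nth mem_nth //.
case: s ks s_uniq => //= a t; case: k => [|k] /= kt /andP[at_ ut].
  by rewrite (memNindex at_) (set_nth_default x0).
by rewrite index_uniq //; apply: set_nth_default; rewrite /=; lia.
Qed.

End CyclicNeighbors.

Section PolygonGraph.
Variables (N : nat) (e : rel nat).
Implicit Types (P Q : seq nat) (a b c p q t v w : nat).

Definition polygon_graph : Prop :=
  [/\ 2 < N, forall x y, e x y -> x < y < N, forall x, x.+1 < N -> e x x.+1,
      e 0 N.-1 & noncrossing ltn e].

Hypothesis graph : polygon_graph.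

Lemma graph_gt2 : 2 < N.
Proof. by case: graph. Qed.

Lemma edge_lt x y : e x y -> x < y < N.
Proof. by case: graph => _ + _ _ _; apply. Qed.

Lemma edge_succ x : x.+1 < N -> e x x.+1.
Proof. by case: graph => _ _ + _ _; apply. Qed.

Lemma edge_outer : e 0 N.-1.
Proof. by case: graph. Qed.

Lemma graph_noncrossing : noncrossing ltn e.
Proof. by case: graph. Qed.

Lemma edge_crossF x y z t : e x y -> e z t -> x < z -> z < y -> y < t -> False.
Proof.
move=> exy ezt xz zy yt; have := graph_noncrossing exy ezt.
by rewrite /= xz zy yt.
Qed.

Lemma extremal_edge (Q : rel nat) (m : nat -> nat -> nat) x0 y0 :
  e x0 y0 -> Q x0 y0 ->
  exists x y, [/\ e x y, Q x y & forall u w, e u w -> Q u w -> m x y <= m u w].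
Proof.
move=> e0 Q0; have ord z t : e z t -> z < N /\ t < N by move/edge_lt; lia.
have [x0N y0N] := ord _ _ e0.
pose admissible (z : 'I_N * 'I_N) := e z.1 z.2 && Q z.1 z.2.
have adm0 : admissible (Ordinal x0N, Ordinal y0N) by rewrite /admissible e0.
case: (arg_minnP (fun z : 'I_N * 'I_N => m z.1 z.2) adm0) => -[x y] /andP[exy Qxy] mxy.
exists x, y; split=> // u w euw Quw; have [uN wN] := ord _ _ euw.
by apply: (mxy (Ordinal uN, Ordinal wN)); rewrite /admissible /= euw.
Qed.

(* With the vertices on a line and the edges drawn as arcs above it, the subgon just
   below the edge (x, y) consists of the vertices from x to y that no other edge
   below (x, y) covers. *)
Definition covered x y v :=
  [exists u : 'I_N, exists w : 'I_N,
    [&& e u w, (u : nat, w : nat) != (x, y), x <= u < v & v < w <= y]].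

Lemma coveredP x y v :
  reflect (exists u w, [/\ e u w, (u, w) <> (x, y), x <= u < v & v < w <= y])
          (covered x y v).
Proof.
apply: (iffP existsP) => [[u /existsP[w /and4P[euw /eqP uw xv vy]]]|].
  by exists u, w.
move=> [u [w [euw uw xv vy]]]; have uwN := edge_lt euw.
have uN : u < N by lia.
have wN : w < N by lia.
exists (Ordinal uN); apply/existsP; exists (Ordinal wN).
by apply/and4P; split=> //; apply/eqP.
Qed.

Definition below x y := [seq v <- index_iota x y.+1 | ~~ covered x y v].

Lemma mem_below x y v : (v \in below x y) = (x <= v <= y) && ~~ covered x y v.
Proof. by rewrite mem_filter mem_index_iota ltnS andbC. Qed.

Lemma below_sorted x y : sorted ltn (below x y).
Proof. by apply: sorted_filter (iota_ltn_sorted _ _); exact: ltn_trans. Qed.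

Lemma below_left x y : x <= y -> x \in below x y.
Proof.
by move=> xy; rewrite mem_below leqnn xy; apply/coveredP => -[u [w []]]; lia.
Qed.

Lemma below_right x y : x <= y -> y \in below x y.
Proof.
by move=> xy; rewrite mem_below leqnn xy; apply/coveredP => -[u [w []]]; lia.
Qed.

Lemma head_below x y : x <= y -> head 0 (below x y) = x.
Proof.
move=> xy; have xb := below_left xy.
have hb : head 0 (below x y) \in below x y.
  by case: (below x y) xb => // a s _; exact: mem_head.
have := sorted_ltn_bounds (below_sorted x y) xb.
by move: hb; rewrite mem_below; lia.
Qed.

Lemma last_below x y : x <= y -> last 0 (below x y) = y.
Proof.
move=> xy; have yb := below_right xy.
have hb : last 0 (below x y) \in below x y.
  by case: (below x y) yb => //= a s _; exact: mem_last.
have := sorted_ltn_bounds (below_sorted x y) yb.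
by move: hb; rewrite mem_below; lia.
Qed.

(* The far end of the longest edge leaving a upwards below (x, y), other than
   (x, y) itself, is not cut off: an edge over it would cross that one. *)
Lemma below_longest_edge x y a : e x y -> x.+1 < y -> a \in below x y -> a < y ->
  exists w, [/\ w \in below x y, e a w, a < w & (a, w) <> (x, y)].
Proof.
move=> exy xy; rewrite mem_below => /andP[xay /coveredP na] ay.
have xyN := edge_lt exy.
have [||b [w [ebw /and3P[/eqP ba wy /eqP aw] maxw]]] :=
    @extremal_edge (fun u w => [&& u == a, w <= y & (a, w) != (x, y)])
      (fun _ w => N - w) a a.+1.
- by apply: edge_succ; lia.
- by rewrite eqxx ay; apply/eqP => -[]; lia.
subst b; have aw_lt := edge_lt ebw.
exists w; split=> //; last by lia.
rewrite mem_below; apply/andP; split; first by lia.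
apply/coveredP => -[u [t [eut ut xuw wty]]].
case: (ltngtP u a) => [ua|au|ua]; last first.
- subst u; have := maxw a t eut; rewrite eqxx.
  have -> : (a, t) != (x, y) by apply/eqP.
  by have := edge_lt eut; lia.
- by apply: (edge_crossF ebw eut); lia.
- by apply: na; exists u, t; split=> //; lia.
Qed.

Lemma below_edge x y a b : e x y -> x.+1 < y -> a \in below x y -> b \in below x y ->
  a < b -> no_between ltn (below x y) a b -> e a b.
Proof.
move=> exy xy aB bB ab /no_betweenP nb.
have ay : a < y by move: bB; rewrite mem_below; lia.
have [w [wB eaw aw naw]] := below_longest_edge exy xy aB ay.
case: (ltngtP w b) => [wb|bw|<- //]; first by case: (nb w).
move: aB bB wB; rewrite !mem_below => /andP[xa _] /andP[_ /coveredP nbc] /andP[wy _].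
by case: nbc; exists a, w; split=> //; lia.
Qed.

Lemma gon_below x y : e x y -> x.+1 < y -> gon ltn e (below x y).
Proof.
move=> exy xy; have xy' : x <= y by lia.
apply/(gonE e ltn_strict_total 0); split; [|exact: below_sorted|].
  have [||w [wB _ xw wy]] := @below_longest_edge x y x exy xy; [exact: below_left|lia|].
  suff : size [:: x; w; y] <= size (below x y) by [].
  apply: uniq_leq_size => [|z]; last first.
    by rewrite !inE => /or3P[]/eqP->; [exact: below_left| |exact: below_right].
  have : w != y by apply/eqP => wE; rewrite wE in wy.
  by rewrite /= !inE; lia.
move=> a b aB bB /= ab; rewrite head_below // last_below //.
case: (boolP (no_between _ _ _ _)) => [nb|]; first by rewrite (below_edge exy).
rewrite negbK => /hasP[c cB /= acb].
apply/idP/idP => [eab|/andP[/eqP-> /eqP->] //].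
move: aB bB cB; rewrite !mem_below => /andP[xa _] /andP[yb _] /andP[_].
apply: contraR => nxy; apply/coveredP; exists a, b; split=> //; [|lia|lia].
by move=> [aE bE]; rewrite aE bE !eqxx in nxy.
Qed.

Section GonFacts.
Variable P : seq nat.
Hypothesis gP : gon ltn e P.

Lemma gon_bounds v : v \in P -> head 0 P <= v <= last 0 P.
Proof. exact/sorted_ltn_bounds/gon_sorted/gP. Qed.

Lemma base_left_mem : head 0 P \in P. Proof. exact: gon_head_mem gP. Qed.

Lemma base_right_mem : last 0 P \in P. Proof. exact: gon_last_mem gP. Qed.

Lemma base_edge : e (head 0 P) (last 0 P).
Proof. exact: (gon_base ltn_strict_total 0 gP). Qed.

Lemma base_middle : exists2 c : nat, c \in P & head 0 P < c < last 0 P.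
Proof. exact: (gon_middle ltn_strict_total 0 gP). Qed.

Lemma gon_ltnN v : v \in P -> v < N.
Proof. by move/gon_bounds; have := edge_lt base_edge; lia. Qed.

Lemma gon_uniq : uniq P.
Proof. exact/(sorted_strict_uniq ltn_strict_total)/gon_sorted/gP. Qed.

Lemma gon_edge_bounds x y p q : e x y -> p \in P -> q \in P -> x < p < y -> x <= q <= y.
Proof.
move=> exy pP qP /andP[xp py]; rewrite leqNgt [q <= y]leqNgt -negb_or; apply/negP.
exact: (gon_separated ltn_strict_total graph_noncrossing gP exy pP qP).
Qed.

Lemma gon_size : 2 < size P. Proof. by case: gP. Qed.

Lemma gon_next_nth k : k < size P ->
  next P (nth 0 P k) = nth 0 P (if k.+1 == size P then 0 else k.+1).
Proof. exact/next_uniq_nth/gon_uniq. Qed.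

Lemma gon_prev_nth k : k < size P ->
  prev P (nth 0 P k) = nth 0 P (if k == 0 then (size P).-1 else k.-1).
Proof. exact/prev_uniq_nth/gon_uniq. Qed.

Lemma mem_gon_below v : (v \in P) = (v \in below (head 0 P) (last 0 P)).
Proof.
have sP := gon_sorted gP; have hP := base_left_mem; have lP := base_right_mem.
have [c cP c_inner] := base_middle.
rewrite mem_below; apply/idP/idP => [vP|/andP[hvl]].
  rewrite gon_bounds //=; apply/coveredP => -[u [w [euw uw hu wl]]]; apply: uw.
  have := gon_edge_bounds euw vP hP; have := gon_edge_bounds euw vP lP.
  by move=> /(_ ltac:(lia)) ? /(_ ltac:(lia)) ?; congr (_, _); lia.
apply: contraR => vP.
have neq_v z : z \in P -> z != v by apply: contraTneq => ->.
have hv := neq_v _ hP; have vl := neq_v _ lP.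
have [||a [b [aP bP eab /= avb /no_betweenP nb]]] :=
    gon_straddle ltn_strict_total gP vP hP lP; [by rewrite /=; lia..|].
have := gon_bounds aP; have := gon_bounds bP => hbl hal.
apply/coveredP; exists a, b; split=> //; [|lia|lia] => -[aE bE].
by apply: (nb c); rewrite //= ?aE ?bE; lia.
Qed.

Lemma gon_eq_below : P = below (head 0 P) (last 0 P).
Proof.
apply: (irr_sorted_eq ltn_trans ltnn) => [||v]; last exact: mem_gon_below.
  exact: gon_sorted gP.
exact: below_sorted.
Qed.

End GonFacts.

Lemma gon_base_inj P Q : gon ltn e P -> gon ltn e Q ->
  head 0 P = head 0 Q -> last 0 P = last 0 Q -> P = Q.
Proof. by move=> gP gQ hE lE; rewrite (gon_eq_below gP) (gon_eq_below gQ) hE lE. Qed.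

Definition gons := undup [seq below x y |
  x <- iota 0 N, y <- [seq y <- iota 0 N | e x y && (x.+1 < y)]].

Lemma gonsP P : reflect (gon ltn e P) (P \in gons).
Proof.
rewrite mem_undup; apply: (iffP allpairsPdep) => [[x [y [_]]]|gP].
  by rewrite mem_filter => /andP[/andP[exy xy] _] ->; exact: gon_below.
exists (head 0 P), (last 0 P); have eb := base_edge gP.
have [c cP c_inner] := base_middle gP.
rewrite mem_filter !mem_iota eb; have := edge_lt eb.
by split; [lia|lia|exact: gon_eq_below].
Qed.

Definition gons_at v := [seq P <- gons | v \in P].

Lemma gons_atP v P : reflect (gon ltn e P /\ v \in P) (P \in gons_at v).
Proof. by rewrite mem_filter andbC; apply: (iffP andP) => -[/gonsP]. Qed.

Lemma gons_at_uniq v : uniq (gons_at v).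
Proof. by rewrite filter_uniq // undup_uniq. Qed.

Lemma gon_next_eq P v w : gon ltn e P -> v \in P -> w \in P -> v < w ->
  no_between ltn P v w -> next P v = w.
Proof.
move=> gP /memn_nth[i iP <-] /memn_nth[j jP <-]; have sP := gon_sorted gP.
rewrite sorted_nth_ltn // => ij.
rewrite (no_between_nth ltn_strict_total) ?ij // => /eqP jE.
by rewrite gon_next_nth // jE ifF //; lia.
Qed.

Lemma gon_next_last P : gon ltn e P -> next P (last 0 P) = head 0 P.
Proof.
move=> gP; have sz := gon_size gP.
by rewrite -nth_last gon_next_nth ?ifT ?nth0 //; lia.
Qed.

Lemma gon_next_cases P v : gon ltn e P -> v \in P ->
  [/\ v < next P v, e v (next P v) & no_between ltn P v (next P v)]
  \/ v = last 0 P /\ next P v = head 0 P.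
Proof.
move=> gP /memn_nth[k kP <-]; have [_ sP ed] := gP.
rewrite gon_next_nth //; case: ifP => [/eqP kE|kE].
  by right; rewrite nth0 -nth_last -kE.
have kP1 : k.+1 < size P by lia.
by left; rewrite sorted_nth_ltn // ed ?eqxx ?(no_between_nth ltn_strict_total) ?ltnSn.
Qed.

Definition cyc_succ v := if v == N.-1 then 0 else v.+1.
Definition cyc_pred v := if v == 0 then N.-1 else v.-1.

Lemma cyc_pred_eq v w : v < N -> w < N -> (v == cyc_pred w) = (w == cyc_succ v).
Proof. by move=> vN wN; rewrite /cyc_succ /cyc_pred; case: ifP; case: ifP; lia. Qed.

Lemma gon_next_neighbor P v : gon ltn e P -> v \in P ->
  (e v (next P v) || e (next P v) v) && (next P v != cyc_pred v).
Proof.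
move=> gP vP; have N_gt2 := graph_gt2.
have [c cP c_inner] := base_middle gP.
have lN := gon_ltnN gP (base_right_mem gP).
rewrite /cyc_pred; case: (gon_next_cases gP vP) => [[vn -> /no_betweenP nb]|[vE ->]] /=.
  case: (eqVneq v 0) => v0; last by lia.
  apply/eqP => nE; apply: (nb c cP); rewrite /= ?nE; first by lia.
  by have := gon_bounds gP vP; lia.
by rewrite {1 2}vE base_edge // orbT /=; case: ifP; lia.
Qed.

Lemma gon_above v w : e v w -> (v, w) <> (0, N.-1) ->
  exists P, [/\ gon ltn e P, v \in P & next P v = w].
Proof.
move=> evw vw_outer; have vwN := edge_lt evw.
have [|x [y [exy /and3P[xv wy vw_xy] shortest]]] :=
    @extremal_edge (fun x y => [&& x <= v, w <= y & (v, w) != (x, y)])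
      (fun x y => y - x) _ _ edge_outer.
  by apply/and3P; split; [lia|lia|apply/eqP].
have xyN := edge_lt exy.
have gP : gon ltn e (below x y).
  by apply: gon_below => //; move: vw_xy; rewrite xpair_eqE; lia.
have end_below z : (z == v) || (z == w) -> z \in below x y.
  move=> zE; rewrite mem_below; apply/andP; split; first by lia.
  apply/coveredP => -[u [t [eut ut xuz zty]]].
  have uv : u <= v.
    by rewrite leqNgt; apply/negP => vu; apply: (edge_crossF evw eut); lia.
  have wt : w <= t.
    by rewrite leqNgt; apply/negP => tw; apply: (edge_crossF eut evw); lia.
  have vw_ut : (v, w) != (u, t) by apply/eqP => -[]; lia.
  have := shortest u t eut; rewrite uv wt vw_ut => /(_ isT) len.
  by apply: ut; congr (_, _); lia.
have vP : v \in below x y by apply: end_below; rewrite eqxx.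
have wP : w \in below x y by apply: end_below; rewrite eqxx orbT.
exists (below x y); split=> //; apply: gon_next_eq => //; first by lia.
move: evw; rewrite (gon_edgeE ltn_strict_total 0 gP) //=; last by lia.
rewrite head_below ?last_below; [|lia..].
by move: vw_xy; rewrite xpair_eqE => /negbTE->; rewrite orbF.
Qed.

Lemma gon_next_exists v w : v < N -> w < N -> e v w || e w v -> w != cyc_pred v ->
  exists P, [/\ gon ltn e P, v \in P & next P v = w].
Proof.
move=> vN wN + w_pred; case/orP => [evw|ewv].
  apply: gon_above => // -[vE wE].
  by move: w_pred; rewrite /cyc_pred vE wE /= eqxx.
have wv : w.+1 < v.
  by move: w_pred; have := edge_lt ewv; rewrite /cyc_pred; case: ifP; lia.
have wv' : w <= v by lia.
have gP := gon_below ewv wv; exists (below w v); split=> //; first exact: below_right.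
by have := gon_next_last gP; rewrite last_below // head_below.
Qed.

Lemma gon_base_sub P Q v w : v < w -> gon ltn e P -> gon ltn e Q ->
  v \in P -> w \in P -> v \in Q -> w \in Q -> (v, w) <> (head 0 Q, last 0 Q) ->
  head 0 Q <= head 0 P /\ last 0 P <= last 0 Q.
Proof.
move=> vw gP gQ vP wP vQ wQ vw_base.
have [p pP pQ] : exists2 p : nat, p \in P & head 0 Q < p < last 0 Q.
  have := gon_bounds gQ vQ; have := gon_bounds gQ wQ => w_bounds v_bounds.
  have [hv|hv] := ltnP (head 0 Q) v; first by exists v => //; lia.
  exists w => //; case: (ltngtP w (last 0 Q)) => wl; [lia|lia|].
  by case: vw_base; congr (_, _); lia.
have baseQ := base_edge gQ.
have := gon_edge_bounds gP baseQ pP (base_left_mem gP) pQ.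
have := gon_edge_bounds gP baseQ pP (base_right_mem gP) pQ.
by lia.
Qed.

Lemma gon_next_inj P Q v : gon ltn e P -> gon ltn e Q -> v \in P -> v \in Q ->
  next P v = next Q v -> P = Q.
Proof.
move=> gP gQ vP vQ nE.
have not_base A : gon ltn e A -> v \in A -> v < next A v ->
    (v, next A v) <> (head 0 A, last 0 A).
  move=> gA vA vn [vE nxE]; have [c cA c_inner] := base_middle gA.
  case: (gon_next_cases gA vA) => [[_ _ /no_betweenP/(_ c cA)]|[_]]; last by lia.
  by rewrite /= nxE {1}vE; move: c_inner => /=; lia.
have [vn|nv] := ltnP v (next P v).
  have nP : next P v \in P by rewrite mem_next.
  have nQ : next P v \in Q by rewrite nE mem_next.
  have P_base := not_base P gP vP vn.
  have Q_base : (v, next P v) <> (head 0 Q, last 0 Q).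
    by rewrite nE; apply: not_base; rewrite -?nE.
  have := gon_base_sub vn gP gQ vP nP vQ nQ Q_base.
  have := gon_base_sub vn gQ gP vQ nQ vP nP P_base.
  by move=> ? ?; apply: gon_base_inj => //; lia.
case: (gon_next_cases gP vP) => [[]|[vE hE]]; first by lia.
case: (gon_next_cases gQ vQ) => [[]|[vE' hE']]; first by lia.
by apply: gon_base_inj => //; [rewrite -hE nE|rewrite -vE].
Qed.

Lemma gon_next_boundary P v : gon ltn e P -> v \in P -> cyc_succ v \in P ->
  next P v = cyc_succ v.
Proof.
move=> gP vP; rewrite /cyc_succ; case: eqP => [vE|_] sP; last first.
  by apply: gon_next_eq => //; apply/no_betweenP => c _ /=; lia.
have := gon_bounds gP vP; have := gon_bounds gP sP.
have := gon_ltnN gP (base_right_mem gP) => lN h0 hv.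
have -> : v = last 0 P by lia.
by rewrite gon_next_last //; lia.
Qed.

Lemma boundary_gon v : v < N ->
  exists P, forall Q, [/\ gon ltn e Q, v \in Q & cyc_succ v \in Q] <-> Q = P.
Proof.
move=> vN; have N_gt2 := graph_gt2.
have [|||P [gP vP nP]] := @gon_next_exists v (cyc_succ v) vN.
- by rewrite /cyc_succ; case: ifP; lia.
- rewrite /cyc_succ; case: ifP => [/eqP->|vN1]; first by rewrite edge_outer orbT.
  by rewrite edge_succ //; lia.
- by rewrite /cyc_succ /cyc_pred; case: ifP; case: ifP; lia.
exists P => Q; split=> [[gQ vQ sQ]|->]; last by split; rewrite -?nP ?mem_next.
by apply: (gon_next_inj gQ gP vQ vP); rewrite nP gon_next_boundary.
Qed.

Definition neighbors v := [seq w <- iota 0 N | e v w || e w v].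

Lemma perm_next_neighbors v : v < N ->
  perm_eq [seq next P v | P <- gons_at v] [seq w <- neighbors v | w != cyc_pred v].
Proof.
move=> vN; apply: uniq_perm.
- rewrite map_inj_in_uniq ?gons_at_uniq // => P Q /gons_atP[gP vP] /gons_atP[gQ vQ].
  exact: gon_next_inj.
- by rewrite !filter_uniq // iota_uniq.
move=> w; rewrite !mem_filter mem_iota /= add0n; apply/mapP/and3P.
  move=> [P /gons_atP[gP vP] ->]; have /andP[-> ->] := gon_next_neighbor gP vP.
  by rewrite (gon_ltnN gP) ?mem_next.
move=> [w_pred vw wN]; have [P [gP vP <-]] := gon_next_exists vN wN vw w_pred.
by exists P => //; apply/gons_atP.
Qed.

Lemma perm_prev_neighbors v : v < N ->
  perm_eq [seq prev P v | P <- gons_at v] [seq w <- neighbors v | w != cyc_succ v].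
Proof.
move=> vN; apply: uniq_perm.
- rewrite map_inj_in_uniq ?gons_at_uniq // => P Q /gons_atP[gP vP] /gons_atP[gQ vQ] pE.
  apply: (@gon_next_inj P Q (prev P v)) => //; first by rewrite mem_prev.
    by rewrite pE mem_prev.
  by rewrite next_prev ?(gon_uniq gP) // pE next_prev ?(gon_uniq gQ).
- by rewrite !filter_uniq // iota_uniq.
move=> w; rewrite !mem_filter mem_iota /= add0n; apply/mapP/and3P.
  move=> [P /gons_atP[gP vP] ->]; have pP : prev P v \in P by rewrite mem_prev.
  have pN := gon_ltnN gP pP; have := gon_next_neighbor gP pP.
  rewrite next_prev ?(gon_uniq gP) // cyc_pred_eq // orbC.
  by case/andP=> -> ->.
move=> [w_succ vw wN]; rewrite -cyc_pred_eq // in w_succ; rewrite orbC in vw.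
have [P [gP wP vE]] := gon_next_exists wN vN vw w_succ.
exists P; first by apply/gons_atP; rewrite -vE mem_next.
by rewrite -vE prev_next ?(gon_uniq gP).
Qed.

Lemma cyc_pred_neighbor v : v < N -> cyc_pred v \in neighbors v.
Proof.
move=> vN; have N_gt2 := graph_gt2; rewrite mem_filter mem_iota /cyc_pred /= add0n.
case: (eqVneq v 0) => [->|v0]; first by rewrite edge_outer /=; lia.
have := @edge_succ v.-1; rewrite prednK; last by lia.
by move=> -> //; rewrite orbT /=; lia.
Qed.

Lemma cyc_succ_neighbor v : v < N -> cyc_succ v \in neighbors v.
Proof.
move=> vN; have N_gt2 := graph_gt2; rewrite mem_filter mem_iota /cyc_succ /= add0n.
case: (eqVneq v N.-1) => [->|vN1]; first by rewrite edge_outer orbT /=; lia.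
by rewrite edge_succ /=; lia.
Qed.

(* Every neighbour of v is the successor of v in one subgon and its predecessor
   in another one, except for the two neighbours of v on the boundary. *)
Lemma sum_next_prev (M : zmodType) (h : nat -> M) v : v < N ->
  (\sum_(P <- gons_at v) (h (next P v) - h (prev P v))
   = h (cyc_succ v) - h (cyc_pred v))%R.
Proof.
move=> vN; rewrite sumrB -(big_map (next^~ v) predT h) -(big_map (prev^~ v) predT h).
rewrite (perm_big _ (perm_next_neighbors vN)) (perm_big _ (perm_prev_neighbors vN)).
rewrite /= !big_filter.
have nb_uniq : uniq (neighbors v) by rewrite filter_uniq // iota_uniq.
have sumE w : w \in neighbors v -> (\sum_(u <- neighbors v | u != w) h u
    = \sum_(u <- neighbors v) h u - h w)%R.
  by move=> wv; rewrite [in RHS](bigD1_seq w) //= addrAC subrr add0r.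
rewrite !sumE ?cyc_pred_neighbor ?cyc_succ_neighbor //.
by rewrite opprB addrC addrA subrK.
Qed.

Definition apex P v := [&& v \in P, head 0 P < v & v < last 0 P].

Lemma gon_apex v : 0 < v < N.-1 -> exists2 P, gon ltn e P & apex P v.
Proof.
move=> v_inner; have [|x [y [exy xvy shortest]]] :=
  @extremal_edge (fun x y => x < v < y) (fun x y => y - x) _ _ edge_outer; first by [].
have xy : x <= y by lia.
exists (below x y); first by apply: gon_below => //; lia.
rewrite /apex head_below // last_below // xvy andbT mem_below.
apply/andP; split; first by lia.
apply/coveredP => -[u [w [euw uw xuv vwy]]]; apply: uw.
by have len := shortest u w euw ltac:(lia); congr (_, _); lia.
Qed.

Lemma apex_edge P v u w : gon ltn e P -> apex P v -> e u w -> u < v < w ->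
  u <= head 0 P /\ last 0 P <= w.
Proof.
move=> gP /and3P[vP _ _] euw uvw.
have := gon_edge_bounds gP euw vP (base_left_mem gP).
have := gon_edge_bounds gP euw vP (base_right_mem gP).
by lia.
Qed.

Lemma apex_inj P Q v : gon ltn e P -> gon ltn e Q -> apex P v -> apex Q v -> P = Q.
Proof.
move=> gP gQ aP aQ; have /and3P[_ hP lP] := aP; have /and3P[_ hQ lQ] := aQ.
have := apex_edge gP aP (base_edge gQ); have := apex_edge gQ aQ (base_edge gP).
by move=> /(_ ltac:(lia)) ? /(_ ltac:(lia)) ?; apply: gon_base_inj => //; lia.
Qed.

Definition apex_gon v := nth [::] gons (find (apex^~ v) gons).

Lemma apex_gonP v : 0 < v < N.-1 -> gon ltn e (apex_gon v) /\ apex (apex_gon v) v.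
Proof.
move=> /gon_apex[P gP aP].
have has_apex : has (apex^~ v) gons by apply/hasP; exists P => //; exact/gonsP.
by split; [apply/gonsP; rewrite mem_nth -?has_find|exact: nth_find has_apex].
Qed.

Lemma apex_gonE P v : gon ltn e P -> apex P v -> apex_gon v = P.
Proof.
move=> gP aP; have bP := edge_lt (base_edge gP).
have [|gA aA] := @apex_gonP v; first by case/and3P: aP; lia.
exact: apex_inj aA aP.
Qed.

Definition depth v :=
  if 0 < v < N.-1 then N - (last 0 (apex_gon v) - head 0 (apex_gon v)) else 0.

Lemma apex_base_longer P Q z : gon ltn e P -> gon ltn e Q -> apex Q z ->
  z = head 0 P \/ z = last 0 P -> last 0 P - head 0 P < last 0 Q - head 0 Q.
Proof.
move=> gP gQ /and3P[_ headz zlast] zE.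
have zP : z \in P by case: zE => ->; [exact: base_left_mem|exact: base_right_mem].
have z_inner : head 0 Q < z < last 0 Q by rewrite headz.
have := gon_edge_bounds gP (base_edge gQ) zP (base_left_mem gP) z_inner.
have := gon_edge_bounds gP (base_edge gQ) zP (base_right_mem gP) z_inner.
by have := edge_lt (base_edge gP); lia.
Qed.

Lemma depth_base_lt v : 0 < v < N.-1 ->
  depth (head 0 (apex_gon v)) < depth v /\ depth (last 0 (apex_gon v)) < depth v.
Proof.
move=> v_inner; have [gP _] := apex_gonP v_inner.
have depth_lt z :
    z = head 0 (apex_gon v) \/ z = last 0 (apex_gon v) -> depth z < depth v.
  move=> zE; have := edge_lt (base_edge gP); rewrite /depth v_inner.
  case: ifP => [z_inner|_]; last by lia.
  have [gQ apexQ] := apex_gonP z_inner; have := edge_lt (base_edge gQ).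
  by have := apex_base_longer gP gQ apexQ zE; lia.
by split; apply: depth_lt; [left|right].
Qed.

End PolygonGraph.

Local Open Scope classical_set_scope.
Local Open Scope ring_scope.

(** * Lengths of diagonals *)

Lemma lez_nat_offset (i j : int) : i <= j -> exists d : nat, j = i + d%:Z.
Proof. by move=> ij; exists `|j - i|%N; lia. Qed.

Lemma ltz_nat_offset (i j : int) : i < j -> exists d : nat, j = i + 1 + d%:Z.
Proof. by move=> ij; apply: lez_nat_offset; lia. Qed.

Definition residue (n : nat) (k : int) : nat := `|(k %% n%:Z)%Z|%N.

Lemma residue_ltn n k : (0 < n)%N -> (residue n k < n)%N.
Proof. by rewrite /residue; lia. Qed.

Lemma residue_divz_eq n k : (0 < n)%N -> k = (k %/ n%:Z)%Z * n%:Z + (residue n k)%:Z.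
Proof. by move=> n0; rewrite /residue gez0_abs ?modz_ge0 -?divz_eq //; lia. Qed.

Lemma residueMDl n q (r : nat) : (r < n)%N -> residue n (q * n%:Z + r%:Z) = r.
Proof. by move=> rn; rewrite /residue modzMDl modz_small //; lia. Qed.

Lemma residue_nat n (r : nat) : (r < n)%N -> residue n r%:Z = r.
Proof. by move=> rn; rewrite -[RHS](residueMDl 0 rn) mul0r add0r. Qed.

Lemma residueS n k : (0 < n)%N -> residue n (k + 1) = cyc_succ n (residue n k).
Proof.
move=> n0; rewrite {1}(residue_divz_eq k n0); have := residue_ltn k n0.
rewrite /cyc_succ; case: ifP => kn rn.
  have -> : (k %/ n%:Z)%Z * n%:Z + (residue n k)%:Z + 1
      = ((k %/ n%:Z)%Z + 1) * n%:Z + 0%:Z by rewrite mulrDl mul1r; lia.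
  exact: residueMDl.
by rewrite -addrA -PoszD addn1 residueMDl; lia.
Qed.

Section ThreeTermRecurrences.
Variables (R : realDomainType) (q : int -> R).
Implicit Types (f g : int -> R) (G H : int -> int -> R) (i j k : int).

Definition three_term f : Prop := forall k, f (k + 1) + f (k - 1) = q k * f k.

(* For i < j the entry G i j is the continuant of q (i + 1), ..., q (j - 1). *)
Definition continuants G : Prop :=
  [/\ forall i, G i i = 0, forall i, G i (i + 1) = 1
    & forall i j, i < j -> G i (j + 1) = q j * G i j - G i (j - 1)].

Lemma continuants_diamond G i j : continuants G -> i <= j ->
  G (i - 1) j * G i (j + 1) - G i j * G (i - 1) (j + 1) = 1.
Proof.
move=> [G0 G1 G_rec] /lez_nat_offset[d ->].
elim: d => [|d IH]; first by rewrite addr0 G0 mul0r subr0 G1 -{2}(subrK 1 i) G1 mulr1.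
have jE : i + d%:Z + 1 = i + d.+1%:Z by lia.
have jE' : i + d.+1%:Z - 1 = i + d%:Z by lia.
rewrite -[RHS]IH jE (G_rec i) ?(G_rec (i - 1) (i + d.+1%:Z)) ?jE'; [ring|lia|lia].
Qed.

Lemma three_term_next f k : three_term f -> f (k + 1) = q k * f k - f (k - 1).
Proof. by move=> f_rec; rewrite -f_rec addrK. Qed.

Definition casoratian f g i j : R := f i * g j - g i * f j.

Lemma casoratian_const f g k : three_term f -> three_term g ->
  casoratian f g k (k + 1) = casoratian f g 0 1.
Proof.
move=> f_rec g_rec; have step i : casoratian f g i (i + 1) = casoratian f g (i - 1) i.
  by rewrite /casoratian !three_term_next //; ring.
elim/int_rect: k => [|n IH|n IH]; first by rewrite add0r.
  by rewrite -IH step; congr casoratian; lia.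
by rewrite -IH [RHS]step; congr casoratian; lia.
Qed.

Lemma continuants_casoratian f g : three_term f -> three_term g ->
  (forall k, casoratian f g k (k + 1) = 1) -> continuants (casoratian f g).
Proof.
move=> f_rec g_rec W1; split=> [i||i j _] //; first by rewrite /casoratian mulrC subrr.
by rewrite /casoratian !three_term_next //; ring.
Qed.

(* Sturm comparison: the quotient of casoratian f g i by f is increasing. *)
Lemma casoratian_gt0 f g i j : (forall k, casoratian f g k (k + 1) = 1) ->
  (forall k, i <= k < j -> 0 < f k) -> 0 <= f j -> i < j -> 0 < casoratian f g i j.
Proof.
move=> W1 f_gt0 fj /ltz_nat_offset[d jE].
elim: d j jE f_gt0 fj => [|d IH] j -> f_gt0 fj; first by rewrite addr0 W1 ltr01.
set k := i + 1 + d%:Z; have fk : 0 < f k by apply: f_gt0; rewrite /k; lia.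
have jE : i + 1 + d.+1%:Z = k + 1 by rewrite /k; lia.
rewrite jE in f_gt0 fj *; have W_gt0 : 0 < casoratian f g i k.
  by apply: IH; rewrite ?(ltW fk) // => l hl; apply: f_gt0; lia.
rewrite -(pmulr_lgt0 _ fk).
have -> : casoratian f g i (k + 1) * f k
    = casoratian f g i k * f (k + 1) + f i * casoratian f g k (k + 1).
  by rewrite /casoratian; ring.
rewrite W1 mulr1 ltr_wpDl ?mulr_ge0 ?(ltW W_gt0) // f_gt0 //; rewrite /k; lia.
Qed.

End ThreeTermRecurrences.

Lemma continuants_eq (R : realDomainType) (q q' : int -> R) (G G' : int -> int -> R)
    (i i' : int) (n : nat) :
  continuants q G -> continuants q' G' ->
  (forall t : nat, (0 < t < n)%N -> q (i + t%:Z) = q' (i' + t%:Z)) ->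
  G i (i + n%:Z) = G' i' (i' + n%:Z).
Proof.
move=> [G0 G1 G_rec] [G'0 G'1 G'_rec].
elim/ltn_ind: n => -[|[|n]] IH q_eq; rewrite ?addr0 ?G0 ?G'0 ?G1 ?G'1 //.
have recE k : k + n.+2%:Z = k + n.+1%:Z + 1 /\ k + n.+1%:Z - 1 = k + n%:Z by lia.
have [iE iE'] := recE i; have [i'E i'E'] := recE i'.
rewrite iE i'E G_rec ?G'_rec ?iE' ?i'E'; [|lia|lia].
rewrite q_eq ?ltnSn // !IH // => t ht; apply: q_eq; lia.
Qed.

Section SineRatio.
Variables (R : realType) (p : nat).
Hypothesis p_gt1 : (1 < p)%N.
Implicit Types (a b : R) (x : int) (k : nat).

(* In a regular p-gon of side 1, a diagonal spanning k sides has length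
   sine_ratio k. *)
Definition sine_ratio x : R := sin (x%:~R * (pi / p%:R)) / sin (pi / p%:R).

Let p_neq0 : p%:R != 0 :> R.
Proof. by rewrite pnatr_eq0; lia. Qed.

Lemma sine_ratio_gt0 k : (0 < k < p)%N -> 0 < sine_ratio k%:Z.
Proof.
have p_gt0 : 0 < p%:R :> R by rewrite ltr0n; lia.
have sin_gt0 j : (0 < j < p)%N -> 0 < sin (j%:R * (pi / p%:R) : R).
  move=> /andP[j0 jp]; apply: sin_gt0_pi; apply/andP; split.
    by rewrite mulr_gt0 ?ltr0n ?divr_gt0 ?pi_gt0.
  by rewrite mulrA ltr_pdivrMr // mulrC ltr_pM2l ?pi_gt0 // ltr_nat.
move=> kp; rewrite divr_gt0 ?sin_gt0 //.
by rewrite -[pi / _]mul1r; apply: (sin_gt0 1%N).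
Qed.

Lemma sine_ratio0 : sine_ratio 0 = 0.
Proof. by rewrite /sine_ratio mulr0z mul0r sin0 mul0r. Qed.

Lemma sine_ratio1 : sine_ratio 1 = 1.
Proof.
have : 0 < sine_ratio 1%N by exact: sine_ratio_gt0.
rewrite /sine_ratio mulr1z mul1r => h; rewrite divff //.
by apply: contraTneq h => ->; rewrite mul0r ltxx.
Qed.

Lemma sine_ratioN x : sine_ratio (- x) = - sine_ratio x.
Proof. by rewrite /sine_ratio mulrNz mulNr sinN mulNr. Qed.

Lemma sine_ratio_alternating : alternating sine_ratio p%:Z.
Proof.
move=> x; rewrite /sine_ratio intrD mulrDl -pmulrn [p%:R * _]mulrCA divff //.
by rewrite mulr1 sinDpi mulNr.
Qed.

Lemma sine_ratio_three_term : three_term (fun=> lambda R p) sine_ratio.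
Proof.
move=> x; rewrite /sine_ratio /lambda -mulrDl [RHS]mulrA; congr (_ / _).
by rewrite intrD intrB mulrDl mulrBl mul1r sinD sinB; ring.
Qed.

Definition sine_interp a b x : R :=
  a * sine_ratio (p%:Z - 1 - x) + b * sine_ratio x.

Let sine_ratio_top : sine_ratio (p%:Z - 1) = 1.
Proof. by rewrite addrC sine_ratio_alternating sine_ratioN opprK sine_ratio1. Qed.

Lemma sine_interp_left a b : sine_interp a b 0 = a.
Proof. by rewrite /sine_interp subr0 sine_ratio_top sine_ratio0 mulr0 addr0 mulr1. Qed.

Lemma sine_interp_right a b : sine_interp a b (p%:Z - 1) = b.
Proof. by rewrite /sine_interp subrr sine_ratio_top sine_ratio0 mulr0 add0r mulr1. Qed.

Lemma sine_interp_alternating a b : alternating (sine_interp a b) p%:Z.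
Proof.
move=> x; rewrite /sine_interp sine_ratio_alternating.
have -> : p%:Z - 1 - (x + p%:Z) = - (x + 1) by lia.
have -> : p%:Z - 1 - x = - (x + 1) + p%:Z by lia.
by rewrite sine_ratio_alternating; ring.
Qed.

Lemma sine_interp_three_term a b : three_term (fun=> lambda R p) (sine_interp a b).
Proof.
move=> x /=; have rec (y : int) := esym (sine_ratio_three_term y).
rewrite /sine_interp mulrDr [_ * (a * _)]mulrCA [_ * (b * _)]mulrCA !rec.
have -> : p%:Z - 1 - (x + 1) = p%:Z - 1 - x - 1 by lia.
have -> : p%:Z - 1 - (x - 1) = p%:Z - 1 - x + 1 by lia.
by ring.
Qed.

Lemma sine_interp_gt0 a b k : 0 < a -> 0 <= b -> (0 < k < p.-1)%N ->
  0 < sine_interp a b k%:Z.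
Proof.
move=> a0 b0 kp; have -> : sine_interp a b k%:Z
    = a * sine_ratio (p.-1 - k)%N%:Z + b * sine_ratio k%:Z.
  by rewrite /sine_interp; congr (_ * sine_ratio _ + _); lia.
have sk : 0 < sine_ratio k%:Z by apply: sine_ratio_gt0; lia.
have spk : 0 < sine_ratio (p.-1 - k)%N%:Z by apply: sine_ratio_gt0; lia.
by apply: ltr_pwDl; [exact: mulr_gt0|exact: mulr_ge0 (ltW sk)].
Qed.

End SineRatio.

Lemma exists_rank_fixpoint (T A : Type) (x0 : A) (rank : T -> nat)
    (step : (T -> A) -> T -> A) :
  (forall f g t, (forall s, (rank s < rank t)%N -> f s = g s) -> step f t = step g t) ->
  exists f, forall t, f t = step f t.
Proof.
move=> step_local; pose it m := iter m step (fun=> x0).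
have it_stable m m' t : (rank t < m)%N -> (rank t < m')%N -> it m t = it m' t.
  elim: m m' t => // m IH [|m'] // t tm tm'.
  by apply: step_local => s st; apply: IH; lia.
exists (fun t => it (rank t).+1 t) => t; apply: step_local => s st.
exact: it_stable.
Qed.

Section AlternatingExtension.
Variables (R : realFieldType) (N : nat) (f : nat -> R).
Hypothesis N_gt0 : (0 < N)%N.

Definition alternating_ext (k : int) : R :=
  (-1) ^ (k %/ N%:Z)%Z * f (residue N k).

Lemma alternating_ext_nat v : (v < N)%N -> alternating_ext v%:Z = f v.
Proof.
move=> vN; rewrite /alternating_ext residue_nat //.
by rewrite divz_small ?expr0z ?mul1r //; lia.
Qed.

Lemma alternating_ext_shift (t k : int) :
  alternating_ext (t * N%:Z + k) = (-1) ^ t * alternating_ext k.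
Proof.
rewrite /alternating_ext /residue modzMDl divzMDl; last by lia.
by rewrite expfzDr ?oppr_eq0 ?oner_eq0 // mulrA.
Qed.

Lemma alternating_extDN k : alternating_ext (k + N%:Z) = - alternating_ext k.
Proof. by rewrite addrC -{1}[N%:Z]mul1r alternating_ext_shift expr1z mulN1r. Qed.

End AlternatingExtension.

(* The relation W i (j + N) = W j i is the glide symmetry of a finite frieze. *)
Lemma glide_gt0 (R : realDomainType) (N : nat) (W : int -> int -> R) : (0 < N)%N ->
  (forall i j : int, W i (j + N%:Z) = W j i) ->
  (forall u v : nat, (u < v < N)%N -> 0 < W u%:Z v%:Z) ->
  forall i j : int, i < j < i + N%:Z -> 0 < W i j.
Proof.
move=> N0 glide W_gt0 i j ij.
have shift (t k l : int) : W (k + t * N%:Z) (l + t * N%:Z) = W k l.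
  elim/int_rect: t k l => [|n IH|n IH] k l; first by rewrite mul0r !addr0.
    by rewrite intS mulrDl mul1r !addrA IH !glide.
  by rewrite intS opprD mulrDl mulN1r !addrA IH -glide subrK -glide subrK.
have W_gt0_int (u v : int) : 0 <= u -> u < v < N%:Z -> 0 < W u v.
  move=> u0 uv; have -> : u = `|u|%N%:Z by lia.
  have -> : v = `|v|%N%:Z by lia.
  by apply: W_gt0; lia.
have rE := divz_eq i N%:Z; have rN : 0 <= (i %% N%:Z)%Z < N%:Z by lia.
rewrite -(shift (- (i %/ N%:Z)%Z)) mulNr.
move: (i %% N%:Z)%Z ((i %/ N%:Z)%Z * N%:Z) rE rN => r m rE rN.
have [jN|jN] := ltP (j - m) N%:Z; first by apply: W_gt0_int; lia.
by rewrite -(subrK N%:Z (j - m)) glide; apply: W_gt0_int; lia.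
Qed.

Section Interpolation.
Variables (R : realType) (N : nat) (e : rel nat).
Hypothesis graph : polygon_graph N e.

Definition interpolating (f : nat -> R) : Prop :=
  forall (P : seq nat) k, gon ltn e P -> (k < size P)%N ->
    f (nth 0%N P k) = sine_interp (size P) (f (head 0%N P)) (f (last 0%N P)) k%:Z.

Lemma interpolating_apex (f : nat -> R) :
  (forall v, (0 < v < N.-1)%N -> let P := apex_gon N e v in
    f v = sine_interp (size P) (f (head 0%N P)) (f (last 0%N P)) (index v P)%:Z) ->
  interpolating f.
Proof.
move=> f_apex P k gP kP; have sz := gon_size gP; have sz1 : (1 < size P)%N by lia.
have [->|k0] := eqVneq k 0%N; first by rewrite nth0 sine_interp_left.
have [->|kl] := eqVneq k (size P).-1.
  by rewrite nth_last predn_int ?sine_interp_right //; lia.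
have aP : apex P (nth 0%N P k).
  rewrite /apex mem_nth // -{1}nth0 -nth_last.
  by rewrite !sorted_nth_ltn ?(gon_sorted gP) //; lia.
have /and3P[_ head_lt lt_last] := aP; have base_bounds := edge_lt graph (base_edge gP).
by rewrite f_apex ?(apex_gonE graph gP aP) ?index_uniq ?(gon_uniq gP) //; lia.
Qed.

Lemma interpolating_exists (a b : R) :
  exists f, [/\ f 0%N = a, f N.-1 = b & interpolating f].
Proof.
pose step (f : nat -> R) v := let P := apex_gon N e v in
  if (0 < v < N.-1)%N then
    sine_interp (size P) (f (head 0%N P)) (f (last 0%N P)) (index v P)%:Z
  else if v == 0%N then a else b.
have [f fE] : exists f, forall v, f v = step f v.
  apply: (exists_rank_fixpoint a (rank := depth N e)) => f g v fg; rewrite /step.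
  by case: ifP => // /(depth_base_lt graph)[? ?]; rewrite !fg.
have N_gt2 := graph_gt2 graph.
exists f; split; [by rewrite fE|rewrite fE /step ifF ?ifF //; lia|].
by apply: interpolating_apex => v v_inner; rewrite fE /step v_inner.
Qed.

Lemma interpolating_gt0 (f : nat -> R) v : interpolating f ->
  0 < f 0%N -> 0 <= f N.-1 -> (v < N.-1)%N -> 0 < f v.
Proof.
move=> f_interp f0 fN; have N_gt2 := graph_gt2 graph.
have [d] := ubnP (depth N e v); elim: d v => // d IH v dv vN.
have [->//|v0] := posnP v; have v_inner : (0 < v < N.-1)%N by rewrite v0.
have := depth_base_lt graph v_inner; have := apex_gonP graph v_inner.
move: (apex_gon N e v) => P [gP /and3P[vP head_lt lt_last]] [depth_head depth_last].
have base_bounds := edge_lt graph (base_edge gP).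
have f_head : 0 < f (head 0%N P) by apply: IH; lia.
have f_last : 0 <= f (last 0%N P).
  have [->//|last_neq] := eqVneq (last 0%N P) N.-1.
  by apply/ltW/IH; lia.
have [k kP kv] := memn_nth vP; rewrite -kv f_interp //.
have sz := gon_size gP; apply: sine_interp_gt0 => //; first by lia.
move: head_lt lt_last; rewrite -kv -nth0 -nth_last.
by rewrite !sorted_nth_ltn ?(gon_sorted gP) //; lia.
Qed.

Definition gon_weight v : R := \sum_(P <- gons_at N e v) lambda R (size P).

(* The value of the alternating extension of f at w, as seen from v: the sign
   changes across the outer edge. *)
Definition signed_value (f : nat -> R) v w := if (v < w)%N then f w else - f w.

Lemma interpolating_next_prev f (P : seq nat) v :
  interpolating f -> gon ltn e P -> v \in P ->
  lambda R (size P) * f v = signed_value f v (next P v) - signed_value f v (prev P v).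
Proof.
move=> f_interp gP /memn_nth[k kP <-]; have sP := gon_sorted gP; have sz := gon_size gP.
have sz1 : (1 < size P)%N by lia.
set c := sine_interp (size P) (f (head 0%N P)) (f (last 0%N P)).
have c_alt : alternating c (size P)%:Z by exact: sine_interp_alternating.
have fE i : (i < size P)%N -> f (nth 0%N P i) = c i%:Z by exact: f_interp.
have nextE : signed_value f (nth 0%N P k) (next P (nth 0%N P k)) = c (k%:Z + 1).
  rewrite (gon_next_nth gP) //; case: ifP => [/eqP kE|kE].
    have P0 : (0 < size P)%N by lia.
    rewrite /signed_value sorted_nth_ltn // ltn0 fE // -c_alt.
    by congr c; lia.
  have kP1 : (k.+1 < size P)%N by lia.
  by rewrite /signed_value sorted_nth_ltn // ltnSn fE //; congr c; lia.
have prevE : signed_value f (nth 0%N P k) (prev P (nth 0%N P k)) = - c (k%:Z - 1).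
  rewrite (gon_prev_nth gP) //; case: ifP => [/eqP kE|kE].
    have lP : ((size P).-1 < size P)%N by lia.
    rewrite /signed_value sorted_nth_ltn // ifT; last by lia.
    by rewrite fE // -c_alt; congr c; lia.
  have kP1 : (k.-1 < size P)%N by lia.
  rewrite /signed_value sorted_nth_ltn // ifF; last by lia.
  by rewrite fE //; congr (- c _); lia.
by rewrite nextE prevE opprK fE // sine_interp_three_term.
Qed.

Lemma interpolating_boundary f v : interpolating f -> (v < N)%N ->
  gon_weight v * f v
  = signed_value f v (cyc_succ N v) - signed_value f v (cyc_pred N v).
Proof.
move=> f_interp vN; rewrite -(sum_next_prev graph) // /gon_weight mulr_suml.
by apply: eq_big_seq => P /(gons_atP graph)[gP vP]; exact: interpolating_next_prev.
Qed.

Definition cyclic_weight (k : int) : R := gon_weight (residue N k).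

Lemma alternating_ext_three_term f : interpolating f ->
  three_term cyclic_weight (alternating_ext N f).
Proof.
move=> f_interp k; have N_gt2 := graph_gt2 graph; have N0 : (0 < N)%N by lia.
set F := alternating_ext N f; have FDN := alternating_extDN f N0.
have F_nat w : (w < N)%N -> f w = F w%:Z by move=> wN; rewrite /F alternating_ext_nat.
have kE := residue_divz_eq k N0; have vN := residue_ltn k N0.
rewrite /cyclic_weight; set v := residue N k in kE vN *.
have succE : signed_value f v (cyc_succ N v) = F (v%:Z + 1).
  rewrite /cyc_succ; case: ifP => [/eqP vE|vE]; rewrite /signed_value.
    by rewrite ltn0 F_nat // -FDN; congr F; lia.
  by rewrite ltnSn F_nat; [congr F|]; lia.
have predE : signed_value f v (cyc_pred N v) = - F (v%:Z - 1).
  rewrite /cyc_pred; case: ifP => [/eqP vE|vE]; rewrite /signed_value.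
    rewrite ifT; last by lia.
    by rewrite F_nat -?FDN; [congr F|]; lia.
  rewrite ifF; last by lia.
  by rewrite F_nat; [congr (- F _)|]; lia.
rewrite [in LHS]kE [in F k]kE -!addrA.
rewrite /F !(alternating_ext_shift f N0) -/F.
by rewrite -mulrDr [RHS]mulrCA -F_nat // interpolating_boundary // succE predE opprK.
Qed.

(* W i j is the length of the diagonal from vertex i to vertex j of the polygon,
   negated at every turn around it. *)
Lemma polygon_lengths : exists2 W : int -> int -> R,
  continuants cyclic_weight W & forall i j : int, i < j < i + N%:Z -> 0 < W i j.
Proof.
have N_gt2 := graph_gt2 graph; have N0 : (0 < N)%N by lia.
have [f [f0 fN f_interp]] := interpolating_exists 1 0.
have [g [g0 gN g_interp]] := interpolating_exists 0 1.
have f_rec := alternating_ext_three_term f_interp.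
have g_rec := alternating_ext_three_term g_interp.
set W := casoratian (alternating_ext N f) (alternating_ext N g).
have W1 k : W k (k + 1) = 1.
  rewrite /W (casoratian_const k f_rec g_rec).
  rewrite -(casoratian_const N.-1%:Z f_rec g_rec) /casoratian.
  have -> : N.-1%:Z + 1 = 0%:Z + N%:Z by lia.
  rewrite !(alternating_extDN _ N0) !alternating_ext_nat; try lia.
  by rewrite f0 fN g0 gN; ring.
exists W; first exact: continuants_casoratian.
apply: (glide_gt0 N0) => [i j|u v uvN].
  by rewrite /W /casoratian !(alternating_extDN _ N0); ring.
have f_gt0 w : (w < N.-1)%N -> 0 < alternating_ext N f w%:Z.
  move=> wN; rewrite alternating_ext_nat; last by lia.
  by apply: (interpolating_gt0 f_interp) => //; rewrite ?f0 ?fN ?ltr01.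
apply: casoratian_gt0 => // [k hk||]; last by lia.
  have -> : k = `|k|%N%:Z by lia.
  by apply: f_gt0; lia.
have [->|vN] := eqVneq v N.-1; last by apply/ltW/f_gt0; lia.
by rewrite alternating_ext_nat ?fN //; lia.
Qed.

End Interpolation.

(** * Matching sums and friezes *)

Lemma fsumrB (R : zmodType) (T : choiceType) (A : set T) (f g : T -> R) :
  finite_set A ->
  \sum_(x \in A) (f x - g x) = \sum_(x \in A) f x - \sum_(x \in A) g x.
Proof. by move=> finA; rewrite !fsbig_finite // sumrB. Qed.

Lemma fsum_diag (R : zmodType) (T : choiceType) (A B : set T) (c : R) :
  \sum_(x \in A) \sum_(y \in B) (if x == y then c else 0) = \sum_(x \in A `&` B) c.
Proof.
rewrite fsbig_mkcondr; apply: eq_fsbigr => x _.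
have [xB|xB] := boolP (x \in B).
  rewrite -(fsbig_widen [set x] B) ?fsbig_set1 ?eqxx // => [_ ->|y [_ /=]].
    by rewrite inE in xB.
  by move=> yx; case: eqP => // xy; case: yx.
by apply: fsbig1 => y yB; case: eqP => // xy; rewrite xy notin_setE in xB.
Qed.

Section Matchings.
Variables (R : realType) (T : tiling).
Implicit Types (P Q X : T) (w : seq T) (i j : int).

Lemma wtL_run_rcons2 P Q X k w :
  wtL_run R P k.+1 (rcons (rcons w Q) X) =
  lambda R (sides X) * wtL_run R P k.+1 (rcons w Q)
  - (if Q == X then wtL_run R P k.+1 w else 0).
Proof.
elim: w P k => [|Y w IH] P k; last first.
  by rewrite !rcons_cons /=; case: eqP => YP; rewrite IH //; case: ifP => _; ring.
rewrite /= [X == Q]eq_sym; case: (eqVneq Q P) => [->|QP].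
  by rewrite eq_sym; case: (eqVneq P X) => [->|PX] /=; ring.
by case: (eqVneq Q X) => [->|QX] /=; ring.
Qed.

Lemma wtL_rcons2 Q X w :
  wtL R (rcons (rcons w Q) X) =
  lambda R (sides X) * wtL R (rcons w Q) - (if Q == X then wtL R w else 0).
Proof.
case: w => [|P w] /=; last exact: wtL_run_rcons2.
by rewrite [X == Q]eq_sym; case: (eqVneq Q X) => [->|_] /=; ring.
Qed.

Lemma matchings_empty i : @matchings T i i = set0.
Proof. by apply/seteqP; split=> w //= -[sz _]; lia. Qed.

Lemma matchings_nil i : @matchings T i (i + 1) = [set [::]].
Proof.
apply/seteqP; split=> w /= => [[sz _]|->]; last by split=> //=; lia.
by apply: size0nil; lia.
Qed.

Lemma matchings_rcons i j : i < j -> @matchings T i (j + 1)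
  = (fun wP => rcons wP.1 wP.2) @` (@matchings T i j `*` incident T j).
Proof.
move=> ij; apply/seteqP; split=> w /=.
  case/lastP: w => [[/=]|w P]; first by lia.
  rewrite /matchings /= size_rcons => -[sz inc].
  have szw : (size w)%:Z = j - i - 1 by lia.
  have jE : i + 1 + (size w)%:Z = j by lia.
  exists (w, P) => //; split; last first.
    by have := inc P (size w) (ltnSn _); rewrite nth_rcons ltnn eqxx /= jE.
  by split=> // P0 k kw; have := inc P0 k (ltnW kw); rewrite nth_rcons kw.
move=> [[v P] /= [[sz inc] Pj] <-]; split; first by rewrite size_rcons; lia.
move=> P0 k; rewrite size_rcons ltnS leq_eqVlt nth_rcons => /orP[/eqP->|kv].
  have -> : i + 1 + (size v)%:Z = j by lia.
  by rewrite ltnn eqxx.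
by rewrite kv; exact: inc.
Qed.

Definition locally_finite : Prop := forall k, finite_set (incident T k).

Definition edges_in_one_tile : Prop :=
  forall k, exists P, incident T k `&` incident T (k + 1) = [set P].

Definition tile_weight (k : int) : R := \sum_(P \in incident T k) lambda R (sides P).

Hypothesis finite_incident : locally_finite.

Lemma finite_matchings i j : finite_set (@matchings T i j).
Proof.
have [ji|ij] := leP j i.
  apply: (sub_finite_set (B := set0)) => // w [sz _] /=; lia.
have {ij} [d ->] := ltz_nat_offset ij.
elim: d => [|d IH]; first by rewrite addr0 matchings_nil; exact: finite_set1.
have -> : i + 1 + d.+1%:Z = i + 1 + d%:Z + 1 by lia.
by rewrite matchings_rcons; [by apply: finite_image; apply: finite_setX|lia].
Qed.

Lemma fsum_matchings_rcons (F : seq T -> R) i j : i < j ->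
  \sum_(w \in @matchings T i (j + 1)) F w
  = \sum_(w \in @matchings T i j) \sum_(P \in incident T j) F (rcons w P).
Proof.
move=> ij; rewrite matchings_rcons // fsbig_image.
  by rewrite [RHS]pair_fsbig //; exact: finite_matchings.
by move=> [w P] [v Q] _ _ /= /rcons_inj[-> ->].
Qed.

Hypothesis one_tile : edges_in_one_tile.

Lemma continuants_matching_sum : continuants tile_weight (matching_sum R T).
Proof.
split=> [i|i|i j ij]; rewrite /matching_sum.
- by rewrite matchings_empty fsbig_set0.
- by rewrite matchings_nil fsbig_set1.
rewrite fsum_matchings_rcons //.
have [->|jE] := eqVneq j (i + 1).
  rewrite addrK matchings_nil matchings_empty fsbig_set0 !fsbig_set1 /= mulr1 subr0.
  by apply: eq_fsbigr => P _; rewrite mulr1 subr0.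
have ik : i < j - 1 by lia.
have kj : j - 1 + 1 = j by rewrite subrK.
move: (j - 1) ik kj => k ik <- {j ij jE}.
rewrite 2!(fsum_matchings_rcons _ ik) mulr_fsumr -fsumrB; last exact: finite_matchings.
apply: eq_fsbigr => w _; have [P PE] := one_tile k.
have -> : wtL R w = \sum_(Q \in incident T k) \sum_(X \in incident T (k + 1))
    (if Q == X then wtL R w else 0) by rewrite fsum_diag PE fsbig_set1.
rewrite mulr_fsumr -fsumrB //; apply: eq_fsbigr => Q _.
rewrite mulr_fsuml -fsumrB //; apply: eq_fsbigr => X _.
exact: wtL_rcons2.
Qed.

End Matchings.

Lemma det_mx33 (R : comPzRingType) (M : nat -> nat -> R) :
  \det (\matrix_(r < 3, c < 3) M r c)
  = M 0%N 0%N * (M 1%N 1%N * M 2%N 2%N - M 1%N 2%N * M 2%N 1%N)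
    - M 0%N 1%N * (M 1%N 0%N * M 2%N 2%N - M 1%N 2%N * M 2%N 0%N)
    + M 0%N 2%N * (M 1%N 0%N * M 2%N 1%N - M 1%N 1%N * M 2%N 0%N).
Proof.
rewrite (expand_det_row _ 0) !big_ord_recl big_ord0 /cofactor.
rewrite !(expand_det_row _ 0) !big_ord_recl !big_ord0 /cofactor !det_mx11 !mxE /=.
by rewrite /bump /= !(add0n, addn0, add1n); ring.
Qed.

Section FriezeComparison.
Variable R : realType.
Implicit Types (F G : int -> int -> R) (q : int -> R) (i j w : int).

Lemma continuants_quiddity q G i : continuants q G -> quiddity G i = q i.
Proof.
move=> [G0 G1 G_rec]; rewrite /quiddity G_rec; last by lia.
by have := G1 (i - 1); rewrite subrK G0 => ->; rewrite mulr1 subr0.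
Qed.

(* The common part of frieze and finite_frieze. *)
Definition frieze_upto w F : Prop :=
  [/\ forall i, F i i = 0, forall i, F i (i + 1) = 1
    & forall i j, i <= j -> (j + 1) - (i - 1) <= w ->
        F (i - 1) j * F i (j + 1) - F i j * F (i - 1) (j + 1) = 1].

(* Each diamond determines its bottom entry from the others, as its top entry does not
   vanish. *)
Lemma frieze_eq_continuants w F G : frieze_upto w F ->
  continuants (quiddity F) G ->
  (forall i j, i < j -> j - i <= w - 2 -> G i j != 0) ->
  forall i j, 0 <= j - i <= w -> F i j = G i j.
Proof.
move=> [F0 F1 F_diamond] G_cont G_neq0 i j ijw; have [G0 G1 _] := G_cont.
have {ijw} [d [dw ->]] : exists d : nat, d%:Z <= w /\ j = i + d%:Z.
  by exists `|j - i|%N; lia.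
elim/ltn_ind: d i dw {j} => -[|[|[|d]]] IH i dw.
- by rewrite addr0 F0 G0.
- by rewrite F1 G1.
- have := continuants_quiddity (i + 1) G_cont; rewrite /quiddity addrK.
  by have -> : i + 1 + 1 = i + 2%:Z by lia.
have F_eq_G k l : `|l - k|%N = d.+1 \/ `|l - k|%N = d.+2 -> k <= l -> F k l = G k l.
  move=> kl k_le_l; have -> : l = k + `|l - k|%N%:Z by lia.
  by apply: IH; lia.
have := F_diamond (i + 1) (i + d.+2%:Z) ltac:(lia) ltac:(lia).
have := continuants_diamond (i := i + 1) (j := i + d.+2%:Z) G_cont ltac:(lia).
rewrite addrK (F_eq_G i (i + d.+2%:Z)) ?(F_eq_G (i + 1)); try lia.
have -> : i + d.+2%:Z + 1 = i + d.+3%:Z by lia.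
move=> <- /eqP; rewrite (inj_eq (addrI _)) eqr_opp (inj_eq (mulfI _)) => [/eqP //|].
by apply: G_neq0; lia.
Qed.

Lemma tame_continuants F : frieze F -> tame F -> continuants (quiddity F) F.
Proof.
move=> [F0 F1 F_diamond] F_tame; split=> // i j ij.
have {ij} [d ->] := ltz_nat_offset ij.
elim/ltn_ind: d i => -[|[|d]] IH i.
- by rewrite addr0 F1 /quiddity addrK F0; ring.
- have := F_diamond (i + 1) (i + 1 + 1) ltac:(lia).
  by rewrite /quiddity !addrK !F1 => diamond; lra.
set k := i + 1 + d.+2%:Z.
have F_rec (r : nat) : (0 < r < 3)%N ->
    F (i + r%:Z) (k + 1) = quiddity F k * F (i + r%:Z) k - F (i + r%:Z) (k - 1).
  move=> r3; have -> : k = i + r%:Z + 1 + (d.+2 - r)%N%:Z by rewrite /k; lia.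
  by apply: IH; lia.
have := F_tame i (k - 1) ltac:(lia).
rewrite (det_mx33 (fun r c => F (i + r%:Z) (k - 1 + c%:Z))) !addr0.
have -> : k - 1 + 2%:Z = k + 1 by lia.
rewrite subrK !F_rec //; have := F_diamond (i + 2%:Z) (k - 1) ltac:(lia).
have -> : i + 2%:Z - 1 = i + 1%:Z by lia.
rewrite subrK => diamond det0.
(* Its last two rows satisfy the recursion, so the determinant is a diamond times the
   error in the recursion for the first row. *)
apply/eqP; rewrite -subr_eq0; apply/eqP.
by rewrite -[LHS]mulr1 -diamond -[RHS]det0; ring.
Qed.

End FriezeComparison.

Section FriezesAndMatchings.
Variables (R : realType) (T : tiling) (F : int -> int -> R).
Hypothesis finite_incident : locally_finite T.
Hypothesis one_tile : edges_in_one_tile T.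
Hypothesis F_real : realizable T F.

Lemma continuants_quiddity_matching_sum : continuants (quiddity F) (matching_sum R T).
Proof.
rewrite (_ : quiddity F = tile_weight R T); first exact: continuants_matching_sum.
by apply/funext => i; exact: F_real.
Qed.

Lemma frieze_upto_matching_sum (w : int) : frieze_upto w F ->
  (forall i j : int, i < j -> j - i <= w - 2 -> 0 < matching_sum R T i j) ->
  forall i j : int, 0 <= j - i <= w -> F i j = matching_sum R T i j.
Proof.
move=> F_frieze S_gt0; apply: frieze_eq_continuants => // [|i j ij ijw].
  exact: continuants_quiddity_matching_sum.
by rewrite lt0r_neq0 // S_gt0.
Qed.

Lemma tame_matching_sum : frieze F -> tame F ->
  forall i j : int, i <= j -> F i j = matching_sum R T i j.
Proof.
move=> F_frieze F_tame i j /lez_nat_offset[d ->].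
have F_cont := tame_continuants F_frieze F_tame.
exact: (continuants_eq F_cont continuants_quiddity_matching_sum).
Qed.

End FriezesAndMatchings.

(** * Windows in polygons and strips *)

Section Window.
Variables (V : choiceType) (lt side : rel V) (D : dissection lt side).
Implicit Types (x y z t : V) (P : seq V) (Q : seq nat).

Lemma edge_noncrossing :
  (forall x y z t, side x y || side z t -> ~~ [&& lt x z, lt z y & lt y t]) ->
  noncrossing lt (edge D).
Proof.
move=> side_nc x y z t exy ezt.
have [xyzt|] := boolP (side x y || side z t); first exact: side_nc.
rewrite negb_or => /andP[/negbTE sxy /negbTE szt].
by apply: (arc_noncrossing (d := D)); [move: exy|move: ezt]; rewrite /edge ?sxy ?szt.
Qed.

Definition subgons_at x : set (seq V) := [set P | subgon D P /\ x \in P].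

Hypothesis lt_order : strict_total lt.
Hypothesis edge_nc : noncrossing lt (edge D).
Variables (N : nat) (pt : nat -> V).

(* The points pt 0, ..., pt (N-1) are the vertices of a union of subgons. *)
Definition window : Prop :=
  [/\ (2 < N)%N,
      forall a b, (a < N)%N -> (b < N)%N -> lt (pt a) (pt b) = (a < b)%N,
      forall a, (a.+1 < N)%N -> edge D (pt a) (pt a.+1)
    & edge D (pt 0%N) (pt N.-1)].

Definition window_edge : rel nat :=
  fun a b => [&& (a < b)%N, (b < N)%N & edge D (pt a) (pt b)].

Definition enclosed v : Prop := forall P, subgons_at (pt v) P ->
  forall x, x \in P -> exists2 a, (a < N)%N & x = pt a.

Hypothesis pt_window : window.

Lemma window_lt a b : (a < N)%N -> (b < N)%N -> lt (pt a) (pt b) = (a < b)%N.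
Proof. by case: pt_window => _ + _ _; apply. Qed.

Lemma window_graph : polygon_graph N window_edge.
Proof.
have [N_gt2 pt_lt pt_succ pt_outer] := pt_window; split=> //.
- by move=> x y /and3P[-> ->].
- by move=> x xN; rewrite /window_edge ltnSn xN pt_succ.
- by rewrite /window_edge pt_outer andbT; lia.
move=> x y z t /and3P[xy yN exy] /and3P[zt tN ezt].
by have := edge_nc exy ezt; rewrite !pt_lt //; lia.
Qed.

Lemma window_inj : {in [pred a | (a < N)%N] &, injective pt}.
Proof.
move=> a b; rewrite !inE => aN bN ptE; have irr := strict_irr lt_order.
by have := window_lt aN bN; have := window_lt bN aN; rewrite ptE !irr; lia.
Qed.

Lemma mem_window Q v : all (fun a => a < N)%N Q -> (v < N)%N ->
  (pt v \in map pt Q) = (v \in Q).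
Proof.
move=> /allP QN vN; apply/mapP/idP => [[a aQ vE]|vQ]; last by exists v.
by rewrite (window_inj _ _ vE) // inE QN.
Qed.

Lemma window_gon Q : all (fun a => a < N)%N Q ->
  gon ltn window_edge Q <-> subgon D (map pt Q).
Proof.
move=> /allP QN.
have nth_pt x0 i : (i < size Q)%N -> nth x0 (map pt Q) i = pt (nth 0%N Q i).
  by move=> iQ; rewrite (nth_map 0%N).
have sortedE : sorted lt (map pt Q) = sorted ltn Q.
  rewrite sorted_map; apply: (@eq_in_sorted _ (mem Q)); last exact/allP.
  by move=> a b aQ bQ; rewrite /= window_lt ?QN.
have edgeE x0 i j : sorted ltn Q -> (i < j < size Q)%N ->
    edge D (nth x0 (map pt Q) i) (nth x0 (map pt Q) j)
    = window_edge (nth 0%N Q i) (nth 0%N Q j).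
  move=> sQ /andP[ij jQ]; have iQ := ltn_trans ij jQ.
  by rewrite /window_edge sorted_nth_ltn // ij QN ?mem_nth ?nth_pt.
split=> -[]; rewrite ?size_map ?sortedE => szQ sQ eQ;
  split; rewrite ?size_map ?sortedE // => x0 i j ijQ; first by rewrite edgeE ?eQ.
have /andP[ij jQ] := ijQ; have iQ := ltn_trans ij jQ.
rewrite !(set_nth_default 0%N x0) // -(edgeE (pt 0%N)) // eQ ?size_map //.
Qed.

Lemma gon_window_ltn Q : gon ltn window_edge Q -> all (fun a => a < N)%N Q.
Proof. by move=> gQ; apply/allP => a; exact: (gon_ltnN window_graph gQ). Qed.

Lemma enclosed_subgon v P : (v < N)%N -> enclosed v -> subgons_at (pt v) P ->
  exists2 Q, gon ltn window_edge Q /\ v \in Q & P = map pt Q.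
Proof.
move=> vN v_enc vP; have P_pt := v_enc P vP.
have [Q QN PE] : exists2 Q, all (fun a => a < N)%N Q & P = map pt Q.
  elim: P {vP} P_pt => [|x P IH] P_pt; first by exists [::].
  have [|Q QN ->] := IH; first by move=> y yP; apply: P_pt; rewrite inE yP orbT.
  have [a aN ->] := P_pt x (mem_head _ _).
  by exists (a :: Q) => //=; rewrite aN.
case: vP; rewrite PE => sP; rewrite mem_window // => vQ.
by exists Q; rewrite // window_gon.
Qed.

Lemma window_subgon v Q : (v < N)%N -> gon ltn window_edge Q ->
  subgons_at (pt v) (map pt Q) <-> v \in Q.
Proof.
move=> vN gQ; have QN := gon_window_ltn gQ; rewrite /subgons_at /= mem_window //.
by rewrite -window_gon //; tauto.
Qed.

Lemma subgons_at_enclosed v : (v < N)%N -> enclosed v ->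
  subgons_at (pt v) = map pt @` [set` gons_at N window_edge v].
Proof.
move=> vN v_enc; apply/seteqP; split=> [P /(enclosed_subgon vN v_enc)[Q gvQ ->]|P].
  by exists Q => //; apply/(gons_atP window_graph).
by move=> [Q /(gons_atP window_graph)[gQ vQ] <-]; apply/window_subgon.
Qed.

Lemma finite_subgons_at v : (v < N)%N -> enclosed v -> finite_set (subgons_at (pt v)).
Proof.
move=> vN v_enc; rewrite subgons_at_enclosed //; apply: finite_image.
by apply/finite_seqP; exists (gons_at N window_edge v).
Qed.

Lemma window_weight (R : realType) v : (v < N)%N -> enclosed v ->
  \sum_(P \in subgons_at (pt v)) lambda R (size P) = gon_weight R N window_edge v.
Proof.
move=> vN v_enc; rewrite subgons_at_enclosed // fsbig_image => [|P Q]; last first.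
  rewrite !inE => /(gons_atP window_graph)[gP _] /(gons_atP window_graph)[gQ _].
  by apply: (inj_in_map window_inj); exact/gon_window_ltn.
rewrite -fsbig_seq ?gons_at_uniq //.
by apply: eq_bigr => Q _; rewrite size_map.
Qed.

Lemma boundary_subgon v : (v < N)%N -> enclosed v ->
  exists P, subgons_at (pt v) `&` subgons_at (pt (cyc_succ N v)) = [set P].
Proof.
move=> vN v_enc; have [Q QE] := boundary_gon window_graph vN.
have sN : (cyc_succ N v < N)%N by rewrite /cyc_succ; case: ifP; lia.
have [gQ vQ sQ] : [/\ gon ltn window_edge Q, v \in Q & cyc_succ N v \in Q] by exact/QE.
exists (map pt Q).
apply/seteqP; split=> [P /=|_ /= ->]; last by split; exact/window_subgon.
move=> [vP sP]; have [Q' [gQ' vQ'] PE] := enclosed_subgon vN v_enc vP.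
by rewrite PE in sP *; congr map; apply/QE; split=> //; exact/(window_subgon sN gQ').
Qed.

End Window.

Section Strip.
Variables (U : choiceType) (lt side : rel (int + U)) (D : dissection lt side).

Definition strip_tiling : tiling :=
  @Tiling (seq (int + U)) (fun k => subgons_at D (inl k)) size.

Definition has_windows : Prop := forall (a : int) (d : nat), exists N pt c,
  window D N pt /\ forall t, (t <= d)%N ->
    [/\ (c + t < N)%N, pt (c + t)%N = inl (a + t%:Z) & enclosed D N pt (c + t)%N].

Hypothesis lt_order : strict_total lt.
Hypothesis edge_nc : noncrossing lt (edge D).
Hypothesis windows : has_windows.

Lemma strip_locally_finite : locally_finite strip_tiling.
Proof.
move=> k; have [N [pt [c [win /(_ 0%N isT)[cN cE c_enc]]]]] := windows k 0.
by have := finite_subgons_at lt_order edge_nc win cN c_enc; rewrite cE addr0.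
Qed.

Lemma strip_edges_in_one_tile : edges_in_one_tile strip_tiling.
Proof.
move=> k; have [N [pt [c [win c_win]]]] := windows k 1.
have [cN cE c_enc] := c_win 0%N isT; have [c1N c1E _] := c_win 1%N isT.
have [P] := boundary_subgon lt_order edge_nc win cN c_enc.
have -> : cyc_succ N (c + 0) = (c + 1)%N by rewrite /cyc_succ ifF; lia.
by rewrite cE c1E addr0; exists P.
Qed.

Lemma strip_matching_sum_gt0 (R : realType) (i j : int) : i < j ->
  0 < matching_sum R strip_tiling i j.
Proof.
move=> ij; have [d d0 jE] : exists2 d, (0 < d)%N & j = i + d%:Z.
  by exists `|j - i|%N; lia.
have [N [pt [c [win c_win]]]] := windows i d.
have [W W_cont W_gt0] := polygon_lengths R (window_graph edge_nc win).
have S_cont := continuants_matching_sum R strip_locally_finite strip_edges_in_one_tile.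
rewrite jE (continuants_eq (i' := c%:Z) S_cont W_cont) => [|t td].
  by apply: W_gt0; have [cdN _ _] := c_win d (leqnn d); lia.
have [ctN ctE ct_enc] := c_win t (ltnW (andP td).2).
rewrite /tile_weight /= -ctE (window_weight lt_order edge_nc win) //.
by rewrite /cyclic_weight -PoszD residue_nat.
Qed.

Lemma strip_frieze_matching_sum (R : realType) (F : int -> int -> R) :
  frieze F -> realizable strip_tiling F ->
  forall i j : int, i <= j -> F i j = matching_sum R strip_tiling i j.
Proof.
move=> [F0 F1 F_diamond] F_real i j ij.
apply: (frieze_upto_matching_sum strip_locally_finite strip_edges_in_one_tile F_real
  (w := j - i)); last by lia.
- by split=> // k l kl _; exact: F_diamond.
- by move=> k l kl _; exact: strip_matching_sum_gt0.
Qed.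

End Strip.

Section PolygonTiling.
Variables (n : nat) (D : polygon_dissection n).
Hypothesis n_gt2 : (2 < n)%N.

Lemma polygon_lt_order : strict_total (@polygon_lt n).
Proof.
split=> [x|y x z|x y]; rewrite /polygon_lt; [lia|lia|].
by rewrite -(inj_eq val_inj) /=; lia.
Qed.

Lemma polygon_noncrossing : noncrossing (@polygon_lt n) (edge D).
Proof.
apply: edge_noncrossing => x y z t; rewrite /polygon_lt /polygon_side.
by have := ltn_ord x; have := ltn_ord y; have := ltn_ord z; have := ltn_ord t; lia.
Qed.

Let n_gt0 : (0 < n)%N. Proof. by lia. Qed.
Let pt (a : nat) : 'I_n := insubd (Ordinal n_gt0) a.

Let ptK a : (a < n)%N -> pt a = a :> nat.
Proof. by move=> an; rewrite /pt val_insubd an. Qed.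

Let polygon_window : window D n pt.
Proof.
split=> // [a b an bn|a an|]; first by rewrite /polygon_lt !ptK.
  by rewrite /edge /polygon_side !ptK ?eqxx //; lia.
by rewrite /edge /polygon_side !ptK ?eqxx ?orbT //; lia.
Qed.

Let polygon_enclosed v : enclosed D n pt v.
Proof.
move=> P _ x _; exists (x : nat); first exact: ltn_ord.
by apply: val_inj => /=; rewrite ptK.
Qed.

Let incident_residue k :
  incident (polygon_tiling D) k = subgons_at D (pt (residue n k)).
Proof.
apply/seteqP; split=> P /= [sP].
  move=> [x xP xk]; split=> //; suff -> : pt (residue n k) = x by [].
  apply: val_inj; rewrite /= ptK ?residue_ltn // /residue -xk modz_small //=.
  by have := ltn_ord x; lia.
move=> kP; split=> //; exists (pt (residue n k)) => //.
by rewrite ptK ?residue_ltn // /residue gez0_abs ?modz_mod // modz_ge0; lia.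
Qed.

Lemma polygon_locally_finite : locally_finite (polygon_tiling D).
Proof.
move=> k; rewrite incident_residue.
apply: (finite_subgons_at polygon_lt_order polygon_noncrossing polygon_window) => //.
exact: residue_ltn.
Qed.

Lemma polygon_edges_in_one_tile : edges_in_one_tile (polygon_tiling D).
Proof.
move=> k; rewrite !incident_residue residueS //.
apply: (boundary_subgon polygon_lt_order polygon_noncrossing polygon_window) => //.
exact: residue_ltn.
Qed.

Lemma polygon_matching_sum_gt0 (R : realType) (i j : int) : i < j < i + n%:Z ->
  0 < matching_sum R (polygon_tiling D) i j.
Proof.
move=> ij; have graph := window_graph polygon_noncrossing polygon_window.
have [W W_cont W_gt0] := polygon_lengths R graph.
have S_cont :=
  continuants_matching_sum R polygon_locally_finite polygon_edges_in_one_tile.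
have jE : j = i + `|j - i|%N%:Z by lia.
rewrite jE (continuants_eq (i' := i) S_cont W_cont) => [|t _].
  by rewrite -jE W_gt0.
rewrite /tile_weight incident_residue /cyclic_weight.
apply: (window_weight polygon_lt_order polygon_noncrossing polygon_window) => //.
exact: residue_ltn.
Qed.

Lemma polygon_frieze_matching_sum (R : realType) (F : int -> int -> R) :
  finite_frieze (n - 3) F -> realizable (polygon_tiling D) F ->
  forall i j : int, 0 <= j - i <= n%:Z ->
    F i j = matching_sum R (polygon_tiling D) i j.
Proof.
move=> [F0 F1 F_diamond _] F_real.
apply: (frieze_upto_matching_sum
  polygon_locally_finite polygon_edges_in_one_tile F_real).
- by split=> // i j ij jn; apply: F_diamond => //; lia.
- by move=> i j ij jn; apply: polygon_matching_sum_gt0; lia.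
Qed.

End PolygonTiling.

(** * Universal covers *)

Lemma translates_beyond (n : nat) (i a b : int) : (0 < n)%N ->
  exists (s : int) (t : nat), i + s * n%:Z < a /\ b < i + (s + t%:Z) * n%:Z.
Proof.
move=> n0; exists (- (`|i - a|%N.+1)%:Z), (`|i - a|%N.+1 + `|i - b|%N.+1)%N.
by split; nia.
Qed.

Lemma punct_lt_order : strict_total punct_lt.
Proof.
split=> [[x|[]]|[y|[]] [x|[]] [z|[]]|[x|[]] [y|[]]] //=; try lia.
by rewrite (inj_eq inl_inj) neq_lt.
Qed.

Section Punctured.
Variables (n : nat) (D : punctured_dissection n).

Lemma punct_noncrossing : noncrossing punct_lt (edge D).
Proof. by apply: edge_noncrossing => -[x|[]] [y|[]] [z|[]] [t|[]] //=; lia. Qed.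

Lemma punct_far_bridges (a b : int) : (0 < n)%N -> exists (l : int) (w : nat),
  [/\ l < a, b < l + w%:Z, edge D (inl l) (inr tt) & edge D (inl (l + w%:Z)) (inr tt)].
Proof.
move=> n0; have [i bridge] := punct_bridging D.
have [s [t [ls rt]]] := translates_beyond i a b n0.
have bridge_deck r : edge D (inl (i + r * n%:Z)) (inr tt).
  by have := punct_periodic D r (inl i) (inr tt); rewrite /edge /= => ->.
exists (i + s * n%:Z), (t * n)%N.
by rewrite PoszM -addrA -mulrDl; split.
Qed.

Variables (l : int) (w : nat).
Hypothesis left_bridge : edge D (inl l) (inr tt).
Hypothesis right_bridge : edge D (inl (l + w%:Z)) (inr tt).

Definition punct_point (p : nat) : int + unit :=
  if (p <= w)%N then inl (l + p%:Z) else inr tt.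

Lemma punct_window : (0 < w)%N -> window D w.+2 punct_point.
Proof.
move=> w0; split=> // [p r pw rw|p pw|].
- by rewrite /punct_point; case: ifP => ?; case: ifP => ? /=; lia.
- rewrite /punct_point ifT; last by lia.
  case: ifP => pw'; first by rewrite /edge /=; apply/orP; left; lia.
  by have -> : p = w by lia.
by rewrite /punct_point /= ltnn addr0.
Qed.

Lemma punct_enclosed p : (0 < p < w)%N -> enclosed D w.+2 punct_point p.
Proof.
move=> pw P [sP]; rewrite {1}/punct_point ifT => [pP|]; last by lia.
have sep := gon_separated punct_lt_order punct_noncrossing sP.
case=> [u|[]] uP; last by exists w.+1; rewrite // /punct_point ltnn.
have lu : l <= u.
  by rewrite leNgt; apply/negP => ul; apply: (sep _ _ _ _ left_bridge pP uP) => /=; lia.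
have ur : u <= l + w%:Z.
  by rewrite leNgt; apply/negP => ru; apply: (sep _ _ _ _ right_bridge uP pP) => /=; lia.
exists `|u - l|%N; first by lia.
by rewrite /punct_point ifT; [congr inl|]; lia.
Qed.

End Punctured.

Lemma punct_has_windows (n : nat) (D : punctured_dissection n) :
  (0 < n)%N -> has_windows D.
Proof.
move=> n0 a d; have [l [w [la br left_bridge right_bridge]]] :=
  punct_far_bridges D a (a + d%:Z) n0.
exists w.+2, (punct_point l w), `|a - l|%N; split.
  by apply: (punct_window left_bridge right_bridge); lia.
move=> t td; split; first by lia.
  by rewrite /punct_point ifT; [congr inl|]; lia.
by apply: (punct_enclosed left_bridge right_bridge); lia.
Qed.

Lemma ann_lt_order : strict_total ann_lt.
Proof.
split=> [[x|x]|[y|y] [x|x] [z|z]|[x|x] [y|y]] //=; try lia.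
  by rewrite (inj_eq inl_inj) neq_lt.
by rewrite (inj_eq inr_inj) neq_lt orbC.
Qed.

Section Annulus.
Variables (n m : nat) (D : annulus_dissection n m).

Lemma ann_noncrossing : noncrossing ann_lt (edge D).
Proof. by apply: edge_noncrossing => -[x|x] [y|y] [z|z] [t|t] //=; lia. Qed.

Lemma ann_far_bridges (a b : int) : (0 < n)%N -> exists (l k : int) (w h : nat),
  [/\ l < a, b < l + w%:Z, edge D (inl l) (inr k)
    & edge D (inl (l + w%:Z)) (inr (k + h%:Z))].
Proof.
move=> n0; have [i [k bridge]] := ann_bridging D.
have [s [t [ls rt]]] := translates_beyond i a b n0.
have bridge_deck r : edge D (inl (i + r * n%:Z)) (inr (k + r * m%:Z)).
  by have := ann_periodic D r (inl i) (inr k); rewrite /edge /= => ->.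
exists (i + s * n%:Z), (k + s * m%:Z), (t * n)%N, (t * m)%N.
by rewrite !PoszM -!addrA -!mulrDl; split.
Qed.

Section AnnulusWindow.
Variables (l k : int) (w h : nat).
Hypothesis left_bridge : edge D (inl l) (inr k).
Hypothesis right_bridge : edge D (inl (l + w%:Z)) (inr (k + h%:Z)).

Definition ann_point (p : nat) : int + int :=
  if (p <= w)%N then inl (l + p%:Z) else inr (k + h%:Z - (p - w.+1)%N%:Z).

Lemma ann_window : (0 < w)%N -> window D (w + h).+2 ann_point.
Proof.
move=> w0; split=> [||p pw|]; first by lia.
- by move=> p r pw rw; rewrite /ann_point; case: ifP => ?; case: ifP => ? /=; lia.
- rewrite /ann_point; case: ifP => pw1; case: ifP => pw2; try lia.
  + by rewrite /edge /=; apply/orP; left; lia.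
  + have -> : p = w by lia.
    by rewrite subnn subr0.
  + by rewrite /edge /=; apply/orP; left; lia.
rewrite /ann_point /= addr0 ifF; last by lia.
by have -> : k + h%:Z - ((w + h).+1 - w.+1)%N%:Z = k by lia.
Qed.

Lemma ann_enclosed p : (0 < p < w)%N -> enclosed D (w + h).+2 ann_point p.
Proof.
move=> pw P [sP]; rewrite {1}/ann_point ifT => [pP|]; last by lia.
have sep := gon_separated ann_lt_order ann_noncrossing sP.
move=> x xP; have xl : ~ (ann_lt x (inl l) || ann_lt (inr k) x).
  by move=> out; apply: (sep _ _ _ _ left_bridge pP xP) => //=; lia.
have xr : ~ (ann_lt (inl (l + w%:Z)) x && ann_lt x (inr (k + h%:Z))).
  by move=> /andP[? ?]; apply: (sep _ _ _ _ right_bridge xP pP) => //=; lia.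
case: x xP xl xr => u _ /= xl xr.
  exists `|u - l|%N; first by lia.
  by rewrite /ann_point ifT; [congr inl|]; lia.
exists (w.+1 + `|(k + h%:Z - u)%R|)%N; first by lia.
by rewrite /ann_point ifF; [congr inr|]; lia.
Qed.

End AnnulusWindow.

Hypothesis n_gt0 : (0 < n)%N.

Lemma ann_has_windows : has_windows D.
Proof.
move=> a d; have [l [k [w [h [la br left_bridge right_bridge]]]]] :=
  ann_far_bridges a (a + d%:Z) n_gt0.
exists (w + h).+2, (ann_point l k w h), `|a - l|%N; split.
  by apply: (ann_window left_bridge right_bridge); lia.
move=> t td; split; first by lia.
  by rewrite /ann_point ifT; [congr inl|]; lia.
by apply: (ann_enclosed left_bridge right_bridge); lia.
Qed.

Section Quotient.
Variable E : seq (int + int) -> seq (int + int) -> Prop.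
Hypothesis E_quotient : quotient_dissection D E.
Implicit Types (P Q X Y : seq (int + int)) (u v w z : int).

Local Notation related := (clos_refl_sym_trans _ (strip_identified D E)).

Lemma same_orbit_inner X Y : same_orbit n m X Y ->
  has_inner_vertex X <-> has_inner_vertex Y.
Proof.
move=> [t ->]; split=> [[k kX]|[k /mapP[[u|u] uX] //= _]]; last by exists u.
by exists (k + t * m%:Z); apply/mapP; exists (inr k).
Qed.

Lemma quotient_inner X Y : E X Y ->
  same_orbit n m X Y \/ has_inner_vertex X /\ has_inner_vertex Y.
Proof.
elim: E_quotient X Y => [X Y XY|E' P Q _ IH [_ _ _ [P_inner Q_inner] _] X Y].
  by left.
have E'_inner X' Y' : E' X' Y' -> has_inner_vertex X' <-> has_inner_vertex Y'.
  by case/IH => [/same_orbit_inner|[]].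
by case=> [/IH //|[/E'_inner ? /E'_inner ?]|[/E'_inner ? /E'_inner ?]]; right; tauto.
Qed.

Lemma related_inner X Y : related X Y ->
  X = Y \/ has_inner_vertex X /\ has_inner_vertex Y.
Proof.
elim=> {X Y} [X Y [_ XY nXY _]|X|X Y _ [->|[]]|X Y Z _ [->|[? ?]] _ [<-|[? ?]]];
  try by [left|right].
by have [|] := quotient_inner XY; [|right].
Qed.

Lemma strip_class_eq P Q : related P Q -> strip_class D E P = strip_class D E Q.
Proof.
move=> PQ; apply/seteqP; split=> X /= h; last exact: rst_trans h.
by apply: rst_trans h; exact: rst_sym.
Qed.

(* Y joins z to the upper line, so no edge of X passes over z. *)
Lemma outer_vertex_between X Y u z w : subgon D X -> subgon D Y ->
  has_inner_vertex Y -> inl z \in Y -> inl u \in X -> inl w \in X -> u <= z <= w ->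
  inl z \in X.
Proof.
move=> sX sY [y yY] zY uX wX uzw.
have [<-//|uz] := eqVneq u z; have [<-//|zw] := eqVneq w z.
apply/negPn/negP => zX.
have [||a [b [_ _ eab /andP[az zb] /no_betweenP nb]]] :=
    gon_straddle ann_lt_order sX zX uX wX; [by rewrite /=; lia..|].
have lt_by : ann_lt b (inr y).
  case: b zb nb {eab} => [//|b] _ /(_ _ wX) /= nb; exfalso.
  by apply: nb => //; case: a az => //= a az; lia.
apply: (gon_separated ann_lt_order ann_noncrossing sY eab zY yY az zb).
by rewrite lt_by orbT.
Qed.

(* The first subgon of the chain with an outer vertex beyond k shares an outer
   vertex up to k with its predecessor. *)
Lemma related_crossing k P0 P Q :
  (forall X u w, subgon D X -> inl u \in X -> inl w \in X -> u <= k < w -> X = P0) ->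
  related P Q -> (forall u, inl u \in P -> u <= k) ->
  (exists2 w, inl w \in Q & k < w) -> related P P0.
Proof.
move=> across /clos_rst_rst1n_iff; elim=> {P Q} [P|P X Q PX XQ IH] P_low [w wQ kw].
  by have := P_low w wQ; lia.
have [[sP sX] [z [zP zX]]] : (subgon D P /\ subgon D X) /\ share_outer_vertex P X.
  by case: PX => -[[? ?] _ _ [z [? ?]]]; split=> //; exists z.
have PX' : related P X.
  by case: PX => ?; [exact: rst_step|apply: rst_sym; exact: rst_step].
have [X_low|] := pselect (forall u, inl u \in X -> u <= k).
  by apply: rst_trans PX' _; apply: IH => //; exists w.
move=> /existsNP[u /not_implyP[uX /negP]]; rewrite -ltNge => ku.
by rewrite -(across X z u) // P_low.
Qed.

Lemma related_edge_subgon k P0 P Q :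
  (forall X, subgon D X -> inl k \in X -> inl (k + 1) \in X -> X = P0) ->
  subgon D P -> subgon D Q -> inl k \in P -> inl (k + 1) \in Q -> related P Q ->
  related P P0.
Proof.
move=> P0_uniq sP sQ kP k1Q PQ; have [PE|[P_inner Q_inner]] := related_inner PQ.
  by rewrite (P0_uniq P) //; [exact: rst_refl|rewrite PE].
have across X u w : subgon D X -> inl u \in X -> inl w \in X -> u <= k < w -> X = P0.
  move=> sX uX wX ukw; apply: P0_uniq => //.
    by apply: (outer_vertex_between sX sP P_inner kP uX wX); lia.
  by apply: (outer_vertex_between sX sQ Q_inner k1Q uX wX); lia.
have [P_low|] := pselect (forall u, inl u \in P -> u <= k).
  by apply: (related_crossing across PQ P_low); exists (k + 1) => //; lia.
move=> /existsNP[u /not_implyP[uP /negP]]; rewrite -ltNge => ku.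
by rewrite (across P k u) //; [exact: rst_refl|lia].
Qed.

Lemma quotient_locally_finite : locally_finite (quotient_cover D E).
Proof.
move=> k; apply: finite_image.
exact: (strip_locally_finite ann_lt_order ann_noncrossing ann_has_windows k).
Qed.

Lemma quotient_edges_in_one_tile : edges_in_one_tile (quotient_cover D E).
Proof.
move=> k; have [P0 P0E] :=
  strip_edges_in_one_tile ann_lt_order ann_noncrossing ann_has_windows k.
have [[sP0 kP0] [_ k1P0]] : (incident (annulus_cover D) k
    `&` incident (annulus_cover D) (k + 1)) P0 by rewrite [X in X _]P0E.
exists (strip_class D E P0); apply/seteqP; split=> C /=; last first.
  by move=> ->; split; exists P0.
move=> [[P [sP kP] <-] [Q [sQ k1Q] QP]]; apply: strip_class_eq.
apply: (@related_edge_subgon k P0 P Q) => // [X sX kX k1X|].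
  by suff : [set P0] X by []; rewrite -P0E.
by have : strip_class D E Q Q := rst_refl _ _ Q; rewrite QP.
Qed.

End Quotient.
End Annulus.

Theorem theorem6p7 (R : realType) (ps : seq nat) (n : nat) (F : int -> int -> R) :
  (forall D : polygon_dissection n,
     (3 <= n)%N ->
     finite_frieze (n - 3) F -> type_Lambda ps F ->
     realizable (polygon_tiling D) F ->
     forall i j : int, 0 <= j - i <= n%:Z ->
       F i j = matching_sum R (polygon_tiling D) i j)
  /\
  ((0 < n)%N -> frieze F -> n_periodic n F -> type_Lambda ps F ->
     (forall D : punctured_dissection n,
        realizable (punctured_cover D) F ->
        forall i j : int, i <= j ->
          F i j = matching_sum R (punctured_cover D) i j)
     /\
     (forall (m : nat) (D : annulus_dissection n m),
        (0 < m)%N ->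
        realizable (annulus_cover D) F ->
        forall i j : int, i <= j ->
          F i j = matching_sum R (annulus_cover D) i j)
     /\
     (forall (m : nat) (D : annulus_dissection n m)
             (E : seq (int + int) -> seq (int + int) -> Prop),
        (0 < m)%N ->
        quotient_dissection D E ->
        tame F ->
        realizable (quotient_cover D E) F ->
        forall i j : int, i <= j ->
          F i j = matching_sum R (quotient_cover D E) i j)).
Proof.
split=> [D n_ge3 F_frieze _ F_real|n_gt0 F_frieze _ _].
  exact: polygon_frieze_matching_sum.
split=> [D F_real|].
  exact: (strip_frieze_matching_sum punct_lt_order (@punct_noncrossing n D)
    (punct_has_windows D n_gt0) F_frieze F_real).
split=> [m D _ F_real|m D E _ E_quotient F_tame F_real].
  exact: (strip_frieze_matching_sum ann_lt_order (@ann_noncrossing n m D)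
    (ann_has_windows D n_gt0) F_frieze F_real).
exact: (tame_matching_sum (quotient_locally_finite D n_gt0 E)
  (quotient_edges_in_one_tile n_gt0 E_quotient) F_real F_frieze F_tame).
Qed.
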